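(* Let $A=\mathbb{F}Q/I$, where $Q$ is the linearly oriented quiver $1\to2\to\cdots\to n$ with arrows $\alpha_i:i\to i+1$, and $I$ is the ideal generated by $k$ minimal relations $R_j=\alpha_{i_j}\alpha_{i_j+1}\cdots\alpha_{i_j+p_j}$, $1\le j\le k$, which are overlap-free. Set $i_0=0$, $i_{k+1}=n$, $p_{k+1}=0$. Then the number of exceptional pairs of $A$ is \begin{align*} &\Biggl[\Biggl(\sum_{j=1}^{k+1}(i_j-i_{j-1})(i_j+p_j)\Biggr)-t_{n-1}\Biggr]^2\\ &\quad-\sum_{j=1}^{k+1}\Biggl[\binom{i_j-i_{j-1}+3}{4}+\binom{i_j-i_{j-1}+2}{4}+p_j\Biggl(\binom{i_j-i_{j-1}+2}{3}+\binom{i_j-i_{j-1}+1}{3}\Biggr)\Biggr]\\ &\quad-\sum_{j=1}^{k+1}\Bigl[6\,t_{i_j-i_{j-1}}+(i_j-i_{j-1})(2g(j)-1)\Bigr]t_{p_j}, \end{align*} where \[ g(j)=i_{j+1}+p_{j+1}+i_{j-1}-2i_j-\frac{2p_j+1}{3}\quad(1\le j\le k),\qquad g(k+1)=0. \]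
   Context: $\mathbb{F}$ is an algebraically closed field and $n\ge 3$. $t_m=\frac{m(m+1)}{2}$ is the $m$-th triangular number. The relation $R_j$ is the path of length $p_j+1$ starting at vertex $i_j$; the relations are listed with $1\le i_1<\cdots<i_k$. The relations are overlap-free if no arrow occurs in two different relations; equivalently $1\le p_j<i_{j+1}-i_j$ for all $1\le j\le k$ (with $i_{k+1}=n$). $A$-modules are finite-dimensional and identified with finite-dimensional representations of $Q$ (linear maps $V_i\to V_{i+1}$) satisfying the relations in $I$. A pair $(M,N)$ of $A$-modules is an exceptional pair if $\operatorname{Hom}_A(N,M)\cong 0$ and $\operatorname{Ext}^i_A(N,M)\cong 0$ for all $i\ge 1$. The number of exceptional pairs is the number of ordered pairs $(M,N)$ of isomorphism classes of indecomposable $A$-modules that are exceptional pairs. *)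

(* Defs.v *)
From HB Require Import structures.
From mathcomp Require Import all_boot all_order all_algebra.

Set Implicit Arguments.
Unset Strict Implicit.
Unset Printing Implicit Defensive.

Import GRing.Theory.
Local Open Scope ring_scope.

(* The quiver 1 -> 2 -> ... -> nvert with arrows alpha_a : a -> a.+1, together
   with relations R_j, 1 <= j <= nrel, where
     R_j = alpha_(i_j) alpha_(i_j + 1) ... alpha_(i_j + p_j)
   for i_j = rstart j and p_j = rlen j; as a path, R_j has length p_j + 1.
   The values of rstart and rlen outside 1 .. nrel play no role. *)
Record bound_quiver := BoundQuiver {
  nvert : nat;
  nrel : nat;
  rstart : nat -> nat;
  rlen : nat -> nat }.

(* The R_j are paths of length at least 2 in the quiver, listed by increasing
   start; the last arrow of the quiver is alpha_(nvert - 1). *)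
Definition relations_wf (A : bound_quiver) : Prop :=
  (forall j, (1 <= j <= nrel A)%N ->
     [/\ (1 <= rstart A j)%N, (1 <= rlen A j)%N
       & (rstart A j + rlen A j < nvert A)%N])
  /\ (forall j, (1 <= j < nrel A)%N -> (rstart A j < rstart A j.+1)%N).

Definition arrow_in (A : bound_quiver) (j a : nat) : bool :=
  (rstart A j <= a <= rstart A j + rlen A j)%N.

Definition overlap_free (A : bound_quiver) : Prop :=
  forall j l a, (1 <= j <= nrel A)%N -> (1 <= l <= nrel A)%N ->
    arrow_in A j a -> arrow_in A l a -> j = l.

(* The composite V x -> V (m + x) of the m maps along the path starting at x. *)
Fixpoint path_map (F : fieldType) (V : nat -> vectType F)
    (h : forall x, 'Hom(V x, V x.+1)) (x m : nat) : 'Hom(V x, V (m + x)%N) :=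
  match m with
  | 0 => \1%VF
  | m'.+1 => (h (m' + x)%N \o path_map h x m')%VF
  end.

(* A finite-dimensional representation is encoded as a family indexed by all of
   nat that vanishes off the vertices 1 .. nvert; the maps leaving or entering
   a non-vertex are then zero. *)
Record amod (F : fieldType) (A : bound_quiver) := AMod {
  sp :> nat -> vectType F;
  mp : forall x, 'Hom(sp x, sp x.+1);
  sp_supp : forall x, ~~ (1 <= x <= nvert A)%N -> \dim {: sp x} = 0%N;
  sp_rel : forall j, (1 <= j <= nrel A)%N ->
    path_map mp (rstart A j) (rlen A j).+1 = 0 }.

Record amor (F : fieldType) (A : bound_quiver) (M N : amod F A) := AMor {
  mor :> forall x, 'Hom(M x, N x);
  mor_comm : forall x, (mp N x \o mor x = mor x.+1 \o mp M x)%VF }.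

Definition azero (F : fieldType) (A : bound_quiver) (M : amod F A) : Prop :=
  forall x, \dim {: M x} = 0%N.

Definition aiso (F : fieldType) (A : bound_quiver) (M N : amod F A) : Prop :=
  exists (f : amor M N) (g : amor N M),
    forall x, (g x \o f x = \1)%VF /\ (f x \o g x = \1)%VF.

Definition pair_hom (F : fieldType) (U V U' V' : vectType F)
    (f : 'Hom(U, U')) (g : 'Hom(V, V')) : 'Hom((U * V)%type, (U' * V')%type) :=
  linfun (fun w : (U * V)%type => (f w.1, g w.2)).

Lemma pair_homE (F : fieldType) (U V U' V' : vectType F)
    (f : 'Hom(U, U')) (g : 'Hom(V, V')) w :
  pair_hom f g w = (f w.1, g w.2).
Proof.
pose h (w : (U * V)%type) : (U' * V')%type := (f w.1, g w.2).
have hlin : linear h by move=> a u v; rewrite /h /= !linearP.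
pose hL := GRing.isLinear.Build F (U * V)%type (U' * V')%type _ h hlin.
pose H : {linear (U * V)%type -> (U' * V')%type} := HB.pack h hL.
exact: (lfunE H w).
Qed.

Section DirectSum.
Variables (F : fieldType) (A : bound_quiver) (M N : amod F A).

Definition dsum_sp (x : nat) : vectType F := (M x * N x)%type.
Definition dsum_mp (x : nat) : 'Hom(dsum_sp x, dsum_sp x.+1) :=
  pair_hom (mp M x) (mp N x).

Lemma dsum_supp x : ~~ (1 <= x <= nvert A)%N -> \dim {: dsum_sp x} = 0%N.
Proof.
move=> hx; have := sp_supp M hx; have := sp_supp N hx.
by rewrite !dimvf => hN hM; rewrite -[LHS]/(dim (M x) + dim (N x))%N hM hN.
Qed.

Lemma dsum_path x m w :
  path_map dsum_mp x m w
    = (path_map (mp M) x m w.1, path_map (mp N) x m w.2).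
Proof.
elim: m => [|m IHm] /=; first by rewrite !id_lfunE; case: w.
by rewrite !comp_lfunE IHm pair_homE.
Qed.

Lemma dsum_rel j : (1 <= j <= nrel A)%N ->
  path_map dsum_mp (rstart A j) (rlen A j).+1 = 0.
Proof.
move=> hj; apply/lfunP => w.
by rewrite dsum_path (sp_rel M hj) (sp_rel N hj) !zero_lfunE.
Qed.

Definition dsum : amod F A := AMod dsum_supp dsum_rel.

End DirectSum.

Definition indecomposable (F : fieldType) (A : bound_quiver) (M : amod F A) :
    Prop :=
  ~ azero M /\
  forall U W : amod F A, aiso M (dsum U W) -> azero U \/ azero W.

Definition projective (F : fieldType) (A : bound_quiver) (P : amod F A) : Prop :=
  forall (M N : amod F A) (g : amor M N) (f : amor P N),
    (forall x, limg (g x) = fullv) ->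
    exists h : amor P M, forall x, (g x \o h x)%VF = f x.

(* ... -> res_obj 2 -> res_obj 1 -> res_obj 0 -> N -> 0 *)
Record proj_resolution (F : fieldType) (A : bound_quiver) (N : amod F A) :=
  ProjResolution {
    res_obj : nat -> amod F A;
    res_d : forall m, amor (res_obj m.+1) (res_obj m);
    res_aug : amor (res_obj 0) N;
    res_proj : forall m, projective (res_obj m);
    res_aug_surj : forall x, limg (res_aug x) = fullv;
    res_exact0 : forall x, limg (res_d 0 x) = lker (res_aug x);
    res_exactS : forall m x, limg (res_d m.+1 x) = lker (res_d m x) }.

Definition hom_zero (F : fieldType) (A : bound_quiver) (N M : amod F A) : Prop :=
  forall (f : amor N M) x, f x = 0.

(* Ext^(m+1)_A(N, M) = 0, with Ext^(m+1) the cohomology in degree m + 1 of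
   Hom_A(P, M) for a projective resolution P of N: every cocycle is a
   coboundary. *)
Definition extS_zero (F : fieldType) (A : bound_quiver) (m : nat)
    (N M : amod F A) : Prop :=
  exists P : proj_resolution N,
    forall f : amor (res_obj P m.+1) M,
      (forall x, (f x \o res_d P m.+1 x = 0)%VF) ->
      exists g : amor (res_obj P m) M, forall x, (f x = g x \o res_d P m x)%VF.

Definition exceptional_pair (F : fieldType) (A : bound_quiver)
    (M N : amod F A) : Prop :=
  hom_zero N M /\ forall m, extS_zero m N M.

(* For an equivalence relation E on T and an E-invariant P, the elements
   satisfying P form exactly m equivalence classes. *)
Definition num_classes (T : Type) (E : T -> T -> Prop) (P : T -> Prop)
    (m : nat) : Prop :=
  exists r : 'I_m -> T,
    [/\ forall a, P (r a),
        forall a b, E (r a) (r b) -> a = b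
      & forall x, P x -> exists a, E x (r a)].

Definition num_exceptional_pairs (F : fieldType) (A : bound_quiver) (m : nat) :
    Prop :=
  num_classes
    (fun X Y : amod F A * amod F A => aiso X.1 Y.1 /\ aiso X.2 Y.2)
    (fun X => [/\ indecomposable X.1, indecomposable X.2
                & exceptional_pair X.1 X.2])
    m.

Definition tri (m : nat) : nat := (m * m.+1)./2.

(* Main.v *)
Require Import Defs.
From HB Require Import structures.
From mathcomp Require Import all_boot all_order all_algebra zify ring.

Set Implicit Arguments.
Unset Strict Implicit.
Unset Printing Implicit Defensive.

Import GRing.Theory.
Local Open Scope ring_scope.

(** The algebra is a Nakayama algebra: each indecomposable module is an interval
module, with a one-dimensional space at each vertex of an interval l <= x < r
that contains no complete relation, and identities between them.  Write reach l
for the largest possible r, so that [l, reach l) is the indecomposable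
projective at l.  Every count below is in terms of this one function.

Classification ([indecomposable_iv]).  Let l be the smallest vertex in the
support of M and v a nonzero vector there.  The images of v along the arrows
span a copy of [l, r), where r is the first vertex at which they vanish.  A
functional that takes the value 1 on the last nonzero image pulls back along the
arrows, and because nothing lies before l these pullbacks give a module map
M -> [l, r) that retracts the inclusion.  An indecomposable M is then equal to
this summand ([retract_split]).

Ext groups ([exceptional_pair_iv]).  In the overlap-free case N = [a, b) has a
projective resolution with terms
   [a, reach a) <- [b, reach b) <- [reach a, reach b) <- 0.
A map from [l, r) is determined by the image of its generator at l
([iv_mor_eq]), so applying Hom(-, M) to it, for M = [c, d), gives a complex of
spaces of dimension at most 1 with terms at a, b and reach a.  Hom and all Ext
groups vanish if and only if this complex is exact, that is, if the points a, b,
reach a that are present in [c, d) are none or a cancelling pair of neighbours.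
That Ext may be computed with this particular resolution is the usual
comparison of resolutions ([ext_vanishes_indep]).

Counting ([sum_exc_quad], [sum_nonexc_from]).  There are
sum_a (reach a - a) indecomposables, which is the number that the formula
squares.  From the square one subtracts the pairs for which exactly one of Hom,
Ext^1, Ext^2 is nonzero.  If these are grouped by the left endpoint x of M (for
Hom) or of N (for Ext^1 and Ext^2), then each group is a sum over intervals in
which reach takes only two values: i_j + p_j + 1 up to the vertex i_j of the
block of x, and the value for the following block after it.  So the number of
pairs is a polynomial in the data of two neighbouring blocks, and summing over x
in the block yields the j-th summand of the formula. *)

(** * Morphisms, submodules and direct summands *)

Lemma linfun_eval (F : fieldType) (U V : vectType F) (f : U -> V) :
  linear f -> linfun f =1 f.
Proof.
move=> flin; pose fL := GRing.isLinear.Build F U V _ f flin.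
pose f' : {linear U -> V} := HB.pack f fL.
exact: (lfunE f').
Qed.

Lemma dim0_eq0 (F : fieldType) (V : vectType F) (v : V) :
  \dim {: V} = 0%N -> v = 0.
Proof.
move/eqP; rewrite dimv_eq0 => /eqP V0.
by apply/eqP; rewrite -memv0 -V0 memvf.
Qed.

Section Morphisms.
Variables (F : fieldType) (A : bound_quiver).
Implicit Types L M N : amod F A.

Lemma amor_mp M N (f : amor M N) x v : mp N x (f x v) = f x.+1 (mp M x v).
Proof. by have /lfunP/(_ v) := mor_comm f x; rewrite !comp_lfunE. Qed.

Lemma amor_of_eval M N (f : forall x, 'Hom(M x, N x)) :
  (forall x v, mp N x (f x v) = f x.+1 (mp M x v)) ->
  forall x, (mp N x \o f x = f x.+1 \o mp M x)%VF.
Proof. by move=> fc x; apply/lfunP => v; rewrite !comp_lfunE. Qed.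

Lemma amor0_subproof M N x v :
  mp N x ((0 : 'Hom(M x, N x)) v) = (0 : 'Hom(M x.+1, N x.+1)) (mp M x v).
Proof. by rewrite !zero_lfunE linear0. Qed.
Definition amor0 M N : amor M N := AMor (amor_of_eval (@amor0_subproof M N)).

Lemma amor_id_subproof M x v :
  mp M x ((\1%VF : 'Hom(M x, M x)) v) = (\1%VF : 'Hom(M x.+1, M x.+1)) (mp M x v).
Proof. by rewrite !id_lfunE. Qed.
Definition amor_id M : amor M M := AMor (amor_of_eval (@amor_id_subproof M)).

Section Operations.
Variables (L M N : amod F A).

Lemma amor_comp_subproof (g : amor M N) (f : amor L M) x v :
  mp N x ((g x \o f x)%VF v) = (g x.+1 \o f x.+1)%VF (mp L x v).
Proof. by rewrite !comp_lfunE (amor_mp g) (amor_mp f). Qed.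
Definition amor_comp g f : amor L N := AMor (amor_of_eval (amor_comp_subproof g f)).

Lemma amor_add_subproof (g f : amor M N) x v :
  mp N x ((g x + f x) v) = (g x.+1 + f x.+1) (mp M x v).
Proof. by rewrite !add_lfunE linearD /= (amor_mp g) (amor_mp f). Qed.
Definition amor_add g f : amor M N := AMor (amor_of_eval (amor_add_subproof g f)).

Lemma amor_sub_subproof (g f : amor M N) x v :
  mp N x ((g x - f x) v) = (g x.+1 - f x.+1) (mp M x v).
Proof. by rewrite !(add_lfunE, opp_lfunE) linearB /= (amor_mp g) (amor_mp f). Qed.
Definition amor_sub g f : amor M N := AMor (amor_of_eval (amor_sub_subproof g f)).

Lemma amor_compE (g : amor M N) (f : amor L M) x v :
  amor_comp g f x v = g x (f x v).
Proof. exact: comp_lfunE. Qed.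
Lemma amor_addE (g f : amor M N) x v : amor_add g f x v = g x v + f x v.
Proof. exact: add_lfunE. Qed.
Lemma amor_subE (g f : amor M N) x v : amor_sub g f x v = g x v - f x v.
Proof. by rewrite /= add_lfunE opp_lfunE. Qed.
End Operations.

Definition amorE := (amor_compE, amor_addE, amor_subE).

Lemma amor0E M N x v : amor0 M N x v = 0.
Proof. exact: zero_lfunE. Qed.

Section Submodule.
Variables (M : amod F A) (U : forall x, {vspace M x}).
Hypothesis mpU : forall x v, v \in U x -> mp M x v \in U x.+1.

Definition sub_sp x : vectType F := subvs_of (U x).
Definition sub_mp x : 'Hom(sub_sp x, sub_sp x.+1) :=
  (linfun (vsproj (U x.+1)) \o mp M x \o linfun vsval)%VF.

Lemma sub_mpE x u : vsval (sub_mp x u) = mp M x (vsval u).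
Proof. by rewrite !comp_lfunE !lfunE /= vsprojK // mpU // subvsP. Qed.

Lemma sub_supp x : ~~ (1 <= x <= nvert A)%N -> \dim {: sub_sp x} = 0%N.
Proof.
move=> /(sp_supp M) M0; apply/eqP.
rewrite dimvf -[X in X == _]/(\dim (U x)) -leqn0 -[X in (_ <= X)%N]M0.
exact/dimvS/subvf.
Qed.

Lemma sub_path x m u :
  vsval (Defs.path_map sub_mp x m u) = Defs.path_map (mp M) x m (vsval u).
Proof.
elim: m => [|m IHm] /=; first by rewrite !id_lfunE.
by rewrite [in LHS]comp_lfunE sub_mpE IHm !comp_lfunE.
Qed.

Lemma sub_rel j : (1 <= j <= nrel A)%N ->
  Defs.path_map sub_mp (rstart A j) (rlen A j).+1 = 0.
Proof.
move=> hj; apply/lfunP => u; apply: subvs_inj.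
by rewrite /= sub_path (sp_rel M hj) !zero_lfunE.
Qed.

Definition submod : amod F A := AMod sub_supp sub_rel.

Lemma submod_mpE x (u : submod x) : vsval (mp submod x u) = mp M x (vsval u).
Proof. exact: sub_mpE. Qed.

Section Corestrict.
Variables (N : amod F A) (f : amor N M).
Hypothesis fU : forall x v, f x v \in U x.

Lemma corestrict_subproof x v :
  mp submod x ((linfun (vsproj (U x)) \o f x)%VF v)
  = (linfun (vsproj (U x.+1)) \o f x.+1)%VF (mp N x v).
Proof.
apply: subvs_inj.
rewrite submod_mpE !comp_lfunE [X in mp M x (vsval X)]lfunE.
by rewrite [X in _ = vsval X]lfunE /= !vsprojK ?fU // (amor_mp f).
Qed.
Definition corestrict : amor N submod :=
  AMor (amor_of_eval corestrict_subproof).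

Lemma corestrictE x v : vsval (corestrict x v) = f x v.
Proof. by rewrite /= comp_lfunE lfunE /= vsprojK ?fU. Qed.
End Corestrict.
End Submodule.

(** Projectivity is about surjections, but a chain map has to be lifted through
    a differential; f is therefore corestricted to the submodule im g, onto
    which g is surjective. *)
Lemma projective_lift P M N (g : amor M N) (f : amor P N) :
  projective P -> (forall x, (limg (f x) <= limg (g x))%VS) ->
  exists h : amor P M, forall x v, g x (h x v) = f x v.
Proof.
move=> projP fg.
have mpI x v : v \in limg (g x) -> mp N x v \in limg (g x.+1).
  by case/memv_imgP => w _ ->; rewrite (amor_mp g) memv_img ?memvf.
have gI x v : g x v \in limg (g x) by rewrite memv_img ?memvf.
have fI x v : f x v \in limg (g x) by apply: (subvP (fg x)); rewrite memv_img ?memvf.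
have surj x : limg (corestrict mpI gI x) = fullv.
  apply/vspaceP => w; rewrite memvf; apply/idP.
  have /memv_imgP[v _ wv] := subvsP w.
  apply/memv_imgP; exists v; rewrite ?memvf //.
  by apply: subvs_inj; rewrite [RHS]corestrictE.
have [h hE] := projP _ _ (corestrict mpI gI) (corestrict mpI fI) surj.
exists h => x v; have /lfunP/(_ v) := hE x; rewrite comp_lfunE.
by move/(congr1 vsval); rewrite !corestrictE.
Qed.

Lemma aiso_sym M N : aiso M N -> aiso N M.
Proof. by case=> f [g fg]; exists g, f => x; case: (fg x). Qed.

(** The retraction r gives M = I + ker r, and I is not zero. *)
Lemma retract_split I M (s : amor I M) (r : amor M I) :
  (forall x v, r x (s x v) = v) -> indecomposable M -> ~ azero I -> aiso M I.
Proof.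
move=> rs [_ indM] In0.
have mpK x v : v \in lker (r x) -> mp M x v \in lker (r x.+1).
  by rewrite !memv_ker -(amor_mp r) => /eqP ->; rewrite linear0.
pose K := submod mpK; pose e := amor_sub (amor_id M) (amor_comp s r).
have eE x v : e x v = v - s x (r x v) by rewrite !amorE /= id_lfunE.
have eK x v : e x v \in lker (r x) by rewrite memv_ker eE linearB /= rs subrr.
pose q : amor M K := corestrict mpK eK.
have qE x v : vsval (q x v) = v - s x (r x v) by rewrite corestrictE eE.
pose f0 x (v : M x) : dsum I K x := (r x v, q x v).
pose g0 x (w : dsum I K x) : M x := s x w.1 + vsval w.2.
have f0l x : linear (@f0 x) by move=> a u v; rewrite /f0 !linearP.
have g0l x : linear (@g0 x).
  by move=> a u v; rewrite /g0 /= !linearP /= scalerDr addrACA.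
have mpD x (w : dsum I K x) : mp (dsum I K) x w = (mp I x w.1, mp K x w.2).
  exact: pair_homE.
have fc x v : mp (dsum I K) x (linfun (@f0 x) v) = linfun (@f0 x.+1) (mp M x v).
  by rewrite !(linfun_eval (@f0l _)) /f0 mpD /= (amor_mp r) (amor_mp q).
have gc x w : mp M x (linfun (@g0 x) w) = linfun (@g0 x.+1) (mp (dsum I K) x w).
  rewrite !(linfun_eval (@g0l _)) mpD /g0 linearD /= submod_mpE; last exact: mpK.
  by congr (_ + _); exact: amor_mp.
have isoM : aiso M (dsum I K).
  exists (AMor (amor_of_eval fc)), (AMor (amor_of_eval gc)) => x.
  have K1 (k : K x) : r x (vsval k) = 0 by apply/eqP; rewrite -memv_ker subvsP.
  split; apply/lfunP => v; rewrite comp_lfunE id_lfunE.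
    by rewrite [X in linfun (@g0 x) X](linfun_eval (@f0l x)) [LHS](linfun_eval (@g0l x))
               /g0 /f0 /= qE addrC subrK.
  rewrite [X in linfun (@f0 x) X](linfun_eval (@g0l x)) [LHS](linfun_eval (@f0l x)).
  case: v => i k; rewrite /g0 /f0 /= linearD /= rs K1 addr0; congr (_, _).
  apply: subvs_inj; rewrite qE linearD /= rs K1 addr0.
  by rewrite addrAC subrr add0r.
have [//|K0] := indM _ _ isoM.
exists r, s => x; split; apply/lfunP => v; rewrite comp_lfunE id_lfunE //.
have := qE x v; rewrite (dim0_eq0 (q x v) (K0 x)) linear0 => /esym/eqP.
by rewrite subr_eq0 => /eqP.
Qed.

End Morphisms.

(** * Independence of the resolution *)

Section Comparison.
Variables (F : fieldType) (A : bound_quiver) (N : amod F A).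
Implicit Types (P Q : proj_resolution N) (M : amod F A).

(** The kernel of the map leaving degree m, the augmentation being the map that
    leaves degree 0; exactness then has the same form in all degrees. *)
Definition cycles P m x : {vspace res_obj P m x} :=
  match m with 0 => lker (res_aug P x) | m'.+1 => lker (res_d P m' x) end.

Lemma limg_res_d P m x : limg (res_d P m x) = cycles P m x.
Proof. by case: m => [|m]; [exact: (res_exact0 P x) | exact: (res_exactS P m x)]. Qed.

Lemma lift_cycles P m (L : amod F A) (f : amor L (res_obj P m)) :
  projective L -> (forall x v, f x v \in cycles P m x) ->
  exists h : amor L (res_obj P m.+1), forall x v, res_d P m x (h x v) = f x v.
Proof.
move=> projL fZ; apply: (projective_lift projL) => x.
by apply/subvP => w /memv_imgP[v _ ->]; rewrite limg_res_d fZ.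
Qed.

(** The comparison of two resolutions, reduced to what can be carried from one
    degree to the next by induction.  On cycles the homotopy identity
    id - phi psi = d s + s d loses its second term, so that nothing needs to be
    remembered about lower degrees, and no infinite sequence of lifts has to be
    chosen. *)
Definition homotopic_at P Q m : Prop :=
  exists (phi : amor (res_obj P m) (res_obj Q m))
         (psi : amor (res_obj Q m) (res_obj P m))
         (s : amor (res_obj Q m) (res_obj Q m.+1)),
    [/\ forall x v, v \in cycles P m x -> phi x v \in cycles Q m x,
        forall x v, v \in cycles Q m x -> psi x v \in cycles P m x
      & forall x v, v \in cycles Q m x ->
          res_d Q m x (s x v) = v - phi x (psi x v)].

(** The map v - phi (psi v) - s (d v) takes its values in the cycles: its
    boundary is d v - phi0 (psi0 (d v)) - d (s (d v)), which is zero because d v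
    is a cycle one degree lower. *)
Lemma homotopic_atS P Q m : homotopic_at P Q m ->
  exists (phi : amor (res_obj P m.+1) (res_obj Q m.+1))
         (psi0 : amor (res_obj Q m) (res_obj P m))
         (psi : amor (res_obj Q m.+1) (res_obj P m.+1))
         (s : amor (res_obj Q m) (res_obj Q m.+1))
         (s' : amor (res_obj Q m.+1) (res_obj Q m.+2)),
    [/\ forall x v, v \in cycles P m.+1 x -> phi x v \in cycles Q m.+1 x,
        forall x v, v \in cycles Q m.+1 x -> psi x v \in cycles P m.+1 x,
        forall x v, res_d P m x (psi x v) = psi0 x (res_d Q m x v)
      & forall x v, res_d Q m.+1 x (s' x v) =
          v - phi x (psi x v) - s x (res_d Q m x v)].
Proof.
case=> phi [psi [s [phiZ psiZ hs]]].
have dZ R x v : res_d R m x v \in cycles R m x.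
  by rewrite -limg_res_d memv_img ?memvf.
have [phi' phi'E] : exists h : amor _ (res_obj Q m.+1), forall x v,
    res_d Q m x (h x v) = amor_comp phi (res_d P m) x v.
  by apply: lift_cycles; [exact: res_proj | move=> x v; rewrite amorE phiZ ?dZ].
have [psi' psi'E] : exists h : amor _ (res_obj P m.+1), forall x v,
    res_d P m x (h x v) = amor_comp psi (res_d Q m) x v.
  by apply: lift_cycles; [exact: res_proj | move=> x v; rewrite amorE psiZ ?dZ].
have [s' s'E] : exists h : amor _ (res_obj Q m.+2), forall x v,
    res_d Q m.+1 x (h x v) =
    amor_sub (amor_sub (amor_id _) (amor_comp phi' psi'))
             (amor_comp s (res_d Q m)) x v.
  apply: lift_cycles; first exact: res_proj.
  move=> x v; rewrite memv_ker !amorE id_lfunE !linearB /= hs ?dZ // phi'E amorE.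
  by rewrite psi'E amorE subrr.
exists phi', psi, psi', s, s'; split=> x v.
- by rewrite !memv_ker phi'E amorE => /eqP ->; rewrite linear0.
- by rewrite !memv_ker psi'E amorE => /eqP ->; rewrite linear0.
- by rewrite psi'E amorE.
- by rewrite s'E !amorE id_lfunE.
Qed.

Lemma homotopicP P Q m : homotopic_at P Q m.
Proof.
elim: m => [|m IHm].
  have aug_lift (R S : proj_resolution N) :
      exists h : amor (res_obj R 0) (res_obj S 0), forall x v,
        res_aug S x (h x v) = res_aug R x v.
    apply: projective_lift; first exact: res_proj.
    by move=> x; rewrite [X in (_ <= X)%VS]res_aug_surj subvf.
  have [phi phiE] := aug_lift P Q; have [psi psiE] := aug_lift Q P.
  have [s sE] : exists h : amor _ (res_obj Q 1), forall x v, res_d Q 0 x (h x v)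
      = amor_sub (amor_id _) (amor_comp phi psi) x v.
    apply: lift_cycles; first exact: res_proj.
    by move=> x v; rewrite memv_ker !amorE id_lfunE linearB /= phiE psiE subrr.
  exists phi, psi, s; split=> x v; rewrite ?memv_ker ?phiE ?psiE //.
  by rewrite sE !amorE id_lfunE.
have [phi [_ [psi [s [s' [phiZ psiZ _ hs']]]]]] := homotopic_atS IHm.
exists phi, psi, s'; split=> // x v; rewrite memv_ker => /eqP dv0.
by rewrite hs' dv0 linear0 subr0.
Qed.

Definition ext_vanishes P m M : Prop :=
  forall f : amor (res_obj P m.+1) M,
    (forall x v, f x (res_d P m.+1 x v) = 0) ->
    exists g : amor (res_obj P m) M, forall x v, f x v = g x (res_d P m x v).

(** A cocycle f on Q becomes a cocycle f phi on P, hence a coboundary g d.  Then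
    f = f (phi psi + s d + d s') = (g psi0 + f s) d. *)
Lemma ext_vanishes_indep P Q m M : ext_vanishes P m M -> ext_vanishes Q m M.
Proof.
move=> vanP f fd0.
have [phi [psi0 [psi [s [s' [phiZ _ psid hs']]]]]] := homotopic_atS (homotopicP P Q m).
have fZ x v : v \in cycles Q m.+1 x -> f x v = 0.
  by rewrite -limg_res_d => /memv_imgP[w _ ->].
have [g gE] : exists g : amor (res_obj P m) M, forall x v,
    amor_comp f phi x v = g x (res_d P m x v).
  apply: vanP => x v; rewrite amorE fZ // phiZ //.
  by rewrite -limg_res_d memv_img ?memvf.
exists (amor_add (amor_comp g psi0) (amor_comp f s)) => x v.
rewrite !amorE -psid -gE amorE; apply/eqP; rewrite addrC -subr_eq -subr_eq0.
apply/eqP; have := fd0 x (s' x v); rewrite hs' !linearB /= => h; rewrite -[RHS]h.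
by rewrite addrAC.
Qed.
End Comparison.

Section IsoInvariance.
Variables (F : fieldType) (A : bound_quiver).
Implicit Types M N : amod F A.

Lemma extS_zeroP m N M (P : proj_resolution N) :
  extS_zero m N M <-> ext_vanishes P m M.
Proof.
split=> [[Q extQ]|extP]; last first.
  exists P => f fd0; have [|g gE] := extP f.
    by move=> x v; have /lfunP/(_ v) := fd0 x; rewrite comp_lfunE zero_lfunE.
  by exists g => x; apply/lfunP => v; rewrite comp_lfunE gE.
apply: (@ext_vanishes_indep _ _ _ Q) => f fd0; have [|g gE] := extQ f.
  by move=> x; apply/lfunP => v; rewrite comp_lfunE zero_lfunE fd0.
by exists g => x v; rewrite gE comp_lfunE.
Qed.

Lemma aisoP M N : aiso M N ->
  exists (f : amor M N) (g : amor N M),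
    (forall x v, g x (f x v) = v) /\ (forall x v, f x (g x v) = v).
Proof.
case=> f [g fg]; exists f, g.
split=> x v; have [gf fg'] := fg x.
  by have /lfunP/(_ v) := gf; rewrite comp_lfunE id_lfunE.
by have /lfunP/(_ v) := fg'; rewrite comp_lfunE id_lfunE.
Qed.

Lemma exceptional_iso M N M' N' :
  aiso M M' -> aiso N N' -> exceptional_pair M N -> exceptional_pair M' N'.
Proof.
case/aisoP=> f [f' [ff' f'f]] /aisoP[g [g' [gg' g'g]]] [hom0 ext0]; split.
  move=> h x; apply/lfunP => v; rewrite zero_lfunE -[h x v]f'f -[v]g'g.
  have := hom0 (amor_comp f' (amor_comp h g)) x => /lfunP/(_ (g' x v)).
  by rewrite !amorE => ->; rewrite zero_lfunE linear0.
move=> m; have [P _] := ext0 0%N.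
have aug_surj x : limg (amor_comp g (res_aug P) x) = fullv.
  apply/vspaceP => w; rewrite memvf; apply/memv_imgP.
  have : g' x w \in limg (res_aug P x) by rewrite res_aug_surj memvf.
  by case/memv_imgP=> v _ wE; exists v; rewrite ?memvf // amorE -wE g'g.
have aug_exact x : limg (res_d P 0 x) = lker (amor_comp g (res_aug P) x).
  rewrite res_exact0; apply/vspaceP => w; rewrite !memv_ker amorE.
  apply/eqP/eqP => [->|/(congr1 (g' x))]; first by rewrite linear0.
  by rewrite gg' linear0.
pose P' := ProjResolution (@res_proj _ _ _ P) aug_surj aug_exact (@res_exactS _ _ _ P).
apply/(extS_zeroP _ _ P') => h hd0.
have [k kE] : exists k : amor (res_obj P m) M, forall x v,
    amor_comp f' h x v = k x (res_d P m x v).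
  by apply: (extS_zeroP m M P).1 => [|x v]; [exact: ext0 | rewrite amorE hd0 linear0].
by exists (amor_comp f k) => x v; rewrite amorE -kE amorE f'f.
Qed.

End IsoInvariance.

(** * Interval modules *)

Section Reach.
Variable A : bound_quiver.

(** The first vertex that a nonzero path starting at l cannot reach: a path is
    stopped by the earliest end of a relation that starts at l or later, and
    otherwise by the end of the quiver. *)
Definition reach (l : nat) : nat :=
  \big[minn/(nvert A).+1]_(1 <= j < (nrel A).+1 | (l <= rstart A j)%N)
    (rstart A j + rlen A j).+1.

Lemma leq_reach l r : (r <= reach l)%N <->
  (r <= (nvert A).+1)%N /\
  forall j, (1 <= j <= nrel A)%N -> (l <= rstart A j)%N ->
    (r <= (rstart A j + rlen A j).+1)%N.
Proof.
rewrite /reach; set s := index_iota _ _.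
have sE j : (j \in s) = (1 <= j <= nrel A)%N by rewrite mem_index_iota.
rewrite (_ : (forall j, _) <-> {in s, forall j, l <= rstart A j ->
    r <= (rstart A j + rlen A j).+1}%N); last first.
  by split=> h j; have := h j; rewrite sE.
elim: s {sE} => [|j s IHs]; first by rewrite big_nil; split=> [|[]].
rewrite big_cons; case: ifP => lj.
  rewrite leq_min; split=> [/andP[rj /IHs[rn hs]]|[rn hs]].
    by split=> // j'; rewrite inE => /predU1P[-> //|/hs].
  rewrite hs ?mem_head //=; apply/IHs; split=> // j' j's.
  by apply: hs; rewrite inE j's orbT.
rewrite IHs; split=> [] [rn hs]; split=> // j'.
  by rewrite inE => /predU1P[->|/hs //]; rewrite lj.
by move=> j's; apply: hs; rewrite inE j's orbT.
Qed.

Lemma reach_le l : (reach l <= (nvert A).+1)%N.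
Proof. by have [] := (leq_reach l (reach l)).1 (leqnn _). Qed.

Lemma reach_mono l l' : (l <= l')%N -> (reach l <= reach l')%N.
Proof.
move=> ll'; apply/leq_reach; split; first exact: reach_le.
move=> j hj l'j; have [_] := (leq_reach l (reach l)).1 (leqnn _).
by apply=> //; apply: leq_trans l'j.
Qed.

Lemma reachP l : reach l = (nvert A).+1 \/
  exists j, [/\ (1 <= j <= nrel A)%N, (l <= rstart A j)%N
              & reach l = (rstart A j + rlen A j).+1].
Proof.
rewrite /reach; set s := index_iota _ _.
have: {subset s <= s} by [].
elim: {1 3 4}s => [|j t IHt] ts; first by rewrite big_nil; left.
have {}IHt := IHt (fun j' h => ts j' (mem_behead (s := j :: t) h)).
rewrite big_cons; case: ifP => // lj; rewrite /minn; case: ifP => // _.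
right; exists j; split=> //.
by have := ts j (mem_head _ _); rewrite mem_index_iota.
Qed.

(** The constraints 1 <= l and r <= reach l are part of the support, so that
    [iv l r] is a module for all l and r, namely zero when [l, r) is
    not an interval of vertices on which the relations hold. *)
Definition insupp (l r x : nat) : bool :=
  [&& (1 <= l)%N, (l <= x)%N, (x < r)%N & (r <= reach l)%N].

End Reach.

(** A space whose dimension is a boolean: F when b holds and 0 otherwise. *)
Section Line.
Variables (F : fieldType) (b : bool).
Definition line_coef (u : 'rV[F]_b) : F := \sum_j u 0 j.
Definition line_vec (c : F) : 'rV[F]_b := const_mx c.

Lemma line_coef_linear : linear (line_coef : 'rV[F]_b -> F^o).
Proof.
move=> a u v; rewrite /line_coef scaler_sumr -big_split.
by apply: eq_bigr => j _; rewrite !mxE.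
Qed.

Lemma line_vec_linear : linear (line_vec : F^o -> 'rV[F]_b).
Proof. by move=> a c d; apply/rowP => j; rewrite !mxE. Qed.

End Line.
Arguments line_vec {F b} c.

Lemma line_coefK (F : fieldType) b : cancel (@line_coef F b) line_vec.
Proof.
case: b => u; apply/rowP => j; last by case: j.
by rewrite mxE /line_coef big_ord1 !ord1.
Qed.

Lemma line_vecK (F : fieldType) (b : bool) : b -> cancel (@line_vec F b) (@line_coef F b).
Proof. by case: b => // _ c; rewrite /line_coef big_ord1 mxE. Qed.

Lemma row_false (F : fieldType) (b : bool) (u v : 'rV[F]_b) : ~~ b -> u = v.
Proof. by case: b u v => // u v _; apply/rowP; case. Qed.

Section Interval.
Variables (F : fieldType) (A : bound_quiver).
Implicit Types (M N : amod F A).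
Local Notation reach := (reach A).
Local Notation insupp := (insupp A).

Section IvDef.
Variables l r : nat.

Definition iv_sp x : vectType F := 'rV[F]_(insupp l r x).
Definition iv_mp x : 'Hom(iv_sp x, iv_sp x.+1) :=
  linfun (fun u : 'rV[F]_(insupp l r x) =>
    line_vec (line_coef u) : 'rV[F]_(insupp l r x.+1)).

Lemma line_vec_coef_linear (b b' : bool) :
  linear (fun u : 'rV[F]_b => line_vec (line_coef u) : 'rV[F]_b').
Proof. by move=> a u v; rewrite line_coef_linear line_vec_linear. Qed.

Lemma iv_mpE x u : iv_mp x u = line_vec (line_coef u).
Proof. exact: (linfun_eval (@line_vec_coef_linear _ _)). Qed.

Lemma iv_supp x : ~~ (1 <= x <= nvert A)%N -> \dim {: iv_sp x} = 0%N.
Proof.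
move=> hx; rewrite dimvf /= /dim /= mul1n; apply/eqP; rewrite eqb0.
apply: contra hx => /and4P[l1 lx xr rl]; have := reach_le A l; lia.
Qed.

Lemma iv_rel j : (1 <= j <= nrel A)%N ->
  Defs.path_map iv_mp (rstart A j) (rlen A j).+1 = 0.
Proof.
move=> hj; apply/lfunP => u; rewrite zero_lfunE.
have [su|nsu] := boolP (insupp l r (rstart A j)); last first.
  by rewrite (row_false u 0 nsu) linear0.
apply: row_false; apply/negP; case/and4P: su => l1 lj _ rl /and4P[_ _ jr _].
have [_ /(_ j hj lj)] := (leq_reach A l r).1 rl; lia.
Qed.

(** The interval module [l, r).  A relation is zero on it because its source or
    its target lies outside the support. *)
Definition iv : amod F A := AMod iv_supp iv_rel.

Definition iv_vec x (c : F) : iv x := line_vec c.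
Definition iv_coef x (u : iv x) : F := line_coef (u : 'rV[F]_(insupp l r x)).

Lemma mp_iv x (u : iv x) : mp iv x u = iv_vec x.+1 (iv_coef u).
Proof. exact: iv_mpE. Qed.

Lemma iv_coefK x (u : iv x) : iv_vec x (iv_coef u) = u.
Proof. exact: line_coefK. Qed.

Lemma iv_vecK x c : insupp l r x -> iv_coef (iv_vec x c) = c.
Proof. by move=> sx; apply: line_vecK. Qed.

Lemma iv_out x (u v : iv x) : ~~ insupp l r x -> u = v.
Proof. exact: row_false. Qed.

Lemma iv_coef_linear x : linear (@iv_coef x : iv x -> F^o).
Proof. exact: line_coef_linear. Qed.

Lemma iv_coefD x c (u v : iv x) : iv_coef (c *: u + v) = c * iv_coef u + iv_coef v.
Proof. exact: iv_coef_linear. Qed.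

Lemma iv_vec_linear x : linear (iv_vec x : F^o -> iv x).
Proof. exact: line_vec_linear. Qed.

Lemma iv_coef0 x : iv_coef (0 : iv x) = 0.
Proof. by rewrite /iv_coef /line_coef big1 // => j _; rewrite mxE. Qed.

Lemma iv_vec0 x : iv_vec x 0 = 0.
Proof. by apply/rowP => j; rewrite !mxE. Qed.

Lemma iv_vecE x c : iv_vec x c = c *: iv_vec x 1.
Proof. by apply/rowP => j; rewrite !mxE mulr1. Qed.

Lemma iv_vec_neq0 x c : insupp l r x -> c != 0 -> iv_vec x c != 0.
Proof.
move=> sx; apply: contraNneq => /(congr1 (@iv_coef x)); rewrite iv_vecK // => ->.
by rewrite iv_coef0.
Qed.

Lemma iv_dim x : \dim {: iv x} = insupp l r x.
Proof. by rewrite dimvf /= /dim /= mul1n. Qed.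

End IvDef.

Section Trace.
Variables (M : amod F A) (a : nat) (v : M a).

(** The image of v under the path from a to x.  Recursion on the target vertex,
    with value 0 before a, avoids the sum of indices in the type of a path
    map. *)
Fixpoint push x : M x :=
  match a =P x with
  | ReflectT e => ecast z (M z) e v
  | ReflectF _ => match x return M x with 0 => 0 | y.+1 => mp M y (push y) end
  end.

Lemma push_id : push a = v.
Proof.
have pushE x (e : a = x) : push x = ecast z (M z) e v.
  by case: x e => [|x] e /=; case: eqP => // e'; rewrite (eq_irrelevance e' e).
exact: (pushE a erefl).
Qed.

Lemma pushS x : (a <= x)%N -> push x.+1 = mp M x (push x).
Proof.
move=> ax; rewrite /=; case: eqP => // e.
by exfalso; move: ax; rewrite e ltnn.
Qed.

Lemma push_path x m : (a <= x)%N ->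
  Defs.path_map (mp M) x m (push x) = push (m + x)%N.
Proof.
move=> ax; elim: m => [|m IHm]; first by rewrite id_lfunE.
by rewrite [LHS]comp_lfunE IHm [RHS]pushS // (leq_trans ax) ?leq_addl.
Qed.

Lemma push_reach : push (reach a) = 0.
Proof.
have [->|[j [hj aj ->]]] := reachP A a.
  by apply: dim0_eq0; apply: sp_supp; rewrite ltnn andbF.
have := push_path (rlen A j).+1 aj; rewrite (sp_rel M hj) zero_lfunE.
by rewrite addSn addnC => <-.
Qed.

End Trace.

Lemma push_nat M N (f : amor M N) a (v : M a) x : f x (push v x) = push (f a v) x.
Proof.
elim: x => [|x IHx] /=; case: eqP => [e|_]; rewrite ?linear0 //.
- by case: _ / e.
- by case: _ / e.
- by rewrite -(amor_mp f) IHx.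
Qed.

Arguments push : simpl never.

Lemma push_iv l r a x c : (a <= x)%N -> insupp l r a ->
  push (iv_vec l r a c) x = iv_vec l r x c.
Proof.
move=> ax sa; rewrite -(subnK ax); elim: (x - a)%N => [|m IHm].
  by rewrite add0n push_id.
rewrite addSn pushS ?leq_addl // IHm mp_iv.
have [sm|nsm] := boolP (insupp l r (m + a)); first by rewrite iv_vecK.
apply: iv_out; apply: contra nsm; move: sa; rewrite /insupp; lia.
Qed.

(** An interval module is generated by its vector at l. *)
Lemma iv_morE l r N (f : amor (iv l r) N) x (u : iv l r x) :
  f x u = iv_coef u *: push (f l (iv_vec l r l 1)) x.
Proof.
have [sx|nsx] := boolP (insupp l r x); last first.
  rewrite (iv_out u 0 nsx) linear0.
  by rewrite iv_coef0 scale0r.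
have [lx sl] : (l <= x)%N /\ insupp l r l by move: sx; rewrite /insupp; lia.
by rewrite -push_nat push_iv // -{1}[u]iv_coefK iv_vecE linearZ.
Qed.

Lemma iv_mor_eq l r N (f g : amor (iv l r) N) :
  (insupp l r l -> f l (iv_vec l r l 1) = g l (iv_vec l r l 1)) ->
  forall x u, f x u = g x u.
Proof.
move=> fg x u; have [sl|nsl] := boolP (insupp l r l).
  by rewrite [LHS]iv_morE [RHS]iv_morE fg.
have nsx : ~~ insupp l r x by apply: contra nsl; rewrite /insupp; lia.
by rewrite (iv_out u 0 nsx) !linear0.
Qed.

(** Conversely, a vector w at l is the image of the generator as soon as it dies
    at r. *)
Section MorFromGenerator.
Variables (N : amod F A) (l r : nat) (w : N l).
Hypothesis w_r : push w r = 0.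

Lemma gen_mor_linear x : linear (fun u : iv l r x => iv_coef u *: push w x).
Proof.
by move=> c u v; rewrite iv_coefD scalerDl scalerA.
Qed.

Lemma gen_mor_subproof x u :
  mp N x (linfun (fun u : iv l r x => iv_coef u *: push w x) u)
  = linfun (fun u : iv l r x.+1 => iv_coef u *: push w x.+1) (mp (iv l r) x u).
Proof.
rewrite !(linfun_eval (@gen_mor_linear _)) linearZ /= mp_iv.
have [sx|nsx] := boolP (insupp l r x); last first.
  by rewrite (iv_out u 0 nsx) iv_coef0 iv_vec0 iv_coef0 !scale0r.
have lx : (l <= x)%N by case/and4P: sx.
have [sx'|nsx'] := boolP (insupp l r x.+1); first by rewrite iv_vecK ?(pushS w lx).
have xr : r = x.+1 by move: sx nsx'; rewrite /insupp; lia.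
by rewrite -(pushS w lx) -xr w_r !scaler0.
Qed.
Definition gen_mor : amor (iv l r) N := AMor (amor_of_eval gen_mor_subproof).

Lemma gen_morE x u : gen_mor x u = iv_coef u *: push w x.
Proof. exact: (linfun_eval (@gen_mor_linear _)). Qed.

Lemma gen_mor_gen : insupp l r l -> gen_mor l (iv_vec l r l 1) = w.
Proof. by move=> sl; rewrite gen_morE iv_vecK // scale1r push_id. Qed.

End MorFromGenerator.

(** Any lift of the image of the generator defines a lift of the morphism,
    because the image of every vector at l dies at reach l. *)
Lemma iv_projective l r : ((l < r)%N -> r = reach l) -> projective (iv l r).
Proof.
move=> lr M N g f gsurj.
have [sl|nsl] := boolP (insupp l r l); last first.
  exists (amor0 _ _) => x; apply/lfunP => u.
  by apply: (iv_mor_eq (f := amor_comp g (amor0 _ _))) => sl; rewrite sl in nsl.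
have rE : r = reach l by apply: lr; case/and4P: sl.
have : f l (iv_vec l r l 1) \in limg (g l) by rewrite gsurj memvf.
case/memv_imgP=> v _ vE.
have v_r : push v r = 0 by rewrite rE push_reach.
exists (gen_mor v_r) => x; apply/lfunP => u.
apply: (iv_mor_eq (f := amor_comp g (gen_mor v_r))) => _.
by rewrite amorE gen_mor_gen.
Qed.

End Interval.

(** * Projective resolutions and extensions of interval modules *)

Section IntervalExt.
Variables (F : fieldType) (A : bound_quiver).
Implicit Types (M N : amod F A).
Local Notation reach := (reach A).
Local Notation insupp := (insupp A).
Local Notation iv := (iv F A).
Local Notation iv_vec := (@iv_vec F A).

(** The morphism [l, r) -> [l', r') that is the identity wherever both modules
    are nonzero. *)
Section Canonical.
Variables l r l' r' : nat.
Hypotheses (ll : (l' <= l)%N) (rr : (r' <= r)%N).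

Lemma iv_can_linear x : linear (fun u : iv l r x => iv_vec l' r' x (iv_coef u)).
Proof. by move=> c u v; rewrite iv_coef_linear iv_vec_linear. Qed.

Lemma iv_can_subproof x (u : iv l r x) :
  mp (iv l' r') x (linfun (fun u : iv l r x => iv_vec l' r' x (iv_coef u)) u)
  = linfun (fun u : iv l r x.+1 => iv_vec l' r' x.+1 (iv_coef u)) (mp (iv l r) x u).
Proof.
rewrite !(linfun_eval (@iv_can_linear _)) !mp_iv.
have [sx'|nsx'] := boolP (insupp l' r' x.+1); last exact: iv_out.
have [sx|nsx] := boolP (insupp l r x); last first.
  by rewrite (iv_out u 0 nsx) !(iv_coef0, iv_vec0).
by rewrite !iv_vecK //; move: sx sx'; rewrite /insupp; lia.
Qed.
Definition iv_can : amor (iv l r) (iv l' r') := AMor (amor_of_eval iv_can_subproof).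

Lemma iv_canE x u : iv_can x u = iv_vec l' r' x (iv_coef u).
Proof. exact: (linfun_eval (@iv_can_linear _)). Qed.

Lemma iv_can_vec x c : insupp l r x -> iv_can x (iv_vec l r x c) = iv_vec l' r' x c.
Proof. by move=> sx; rewrite iv_canE iv_vecK. Qed.
End Canonical.

Lemma iv_can_exact l2 r2 l1 r1 l0 r0 (l12 : (l1 <= l2)%N) (r12 : (r1 <= r2)%N)
    (l01 : (l0 <= l1)%N) (r01 : (r0 <= r1)%N) x :
  (insupp l1 r1 x -> insupp l2 r2 x = ~~ insupp l0 r0 x) ->
  limg (iv_can l12 r12 x) = lker (iv_can l01 r01 x).
Proof.
move=> s20; apply/vspaceP => w; rewrite memv_ker iv_canE.
have [s1|ns1] := boolP (insupp l1 r1 x); last first.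
  by rewrite (iv_out w 0 ns1) mem0v iv_coef0 iv_vec0 eqxx.
have {}s20 := s20 s1.
have [s0|ns0] := boolP (insupp l0 r0 x).
  have {}s20 : ~~ insupp l2 r2 x by rewrite s20 s0.
  apply/memv_imgP/eqP => [[u _ ->]|].
    by rewrite (iv_out u 0 s20) linear0 iv_coef0 iv_vec0.
  move/(congr1 (@iv_coef _ _ _ _ _)); rewrite iv_vecK // iv_coef0 => w0.
  by exists 0; rewrite ?memvf // linear0 -[w]iv_coefK w0 iv_vec0.
rewrite (iv_out (iv_vec l0 r0 x _) 0 ns0) eqxx.
apply/memv_imgP; exists (iv_vec l2 r2 x (iv_coef w)); rewrite ?memvf //.
by rewrite iv_canE iv_vecK ?iv_coefK // s20.
Qed.

(** Without the cancellation of equal terms the resolution of [a, b) is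
    [a, Ea) <- [b, Eb) <- [Ea, Eb) <- 0, where E is reach: the kernel of
    [a, Ea) -> [a, b) is [b, Ea), and that of [b, Eb) -> [b, Ea) is [Ea, Eb).
    The hypothesis on reach says that this last interval is empty or
    projective.  From degree 3 on the zero module is written [Eb, Eb), which
    keeps both sequences of endpoints monotone, so that all maps are
    canonical. *)
Section Resolution.
Variables a b : nat.
Hypotheses (a1 : (1 <= a)%N) (ab : (a < b)%N) (ba : (b <= reach a)%N).
Hypothesis reach2 : (reach a < reach b)%N -> reach (reach a) = reach b.

Definition res_l m := match m with 0 => a | 1 => b | 2 => reach a | _ => reach b end.
Definition res_r m := match m with 0 => reach a | _ => reach b end.

Let reach_ab : (reach a <= reach b)%N.
Proof. exact/reach_mono/ltnW. Qed.

Lemma res_l_mono m : (res_l m <= res_l m.+1)%N.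
Proof. by case: m => [|[|[|m]]] //=; rewrite ltnW. Qed.

Lemma res_r_mono m : (res_r m <= res_r m.+1)%N.
Proof. by case: m. Qed.

Lemma res_aug_mono : (b <= res_r 0)%N. Proof. by []. Qed.

Lemma iv_res_proj m : projective (iv (res_l m) (res_r m)).
Proof.
apply: iv_projective; case: m => [|[|[|m]]] //=; last by rewrite ltnn.
by move=> h; rewrite reach2.
Qed.

Lemma iv_res_aug_surj x :
  limg (iv_can (leqnn a) res_aug_mono x : 'Hom(iv (res_l 0) (res_r 0) x, iv a b x))
  = fullv.
Proof.
apply/vspaceP => w; rewrite memvf; apply/memv_imgP.
have [sx|nsx] := boolP (insupp a b x); last first.
  by exists 0; rewrite ?memvf //; apply: iv_out.
exists (iv_vec a (reach a) x (iv_coef w)); rewrite ?memvf // iv_canE iv_vecK ?iv_coefK //.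
by move: sx; rewrite /insupp /=; lia.
Qed.

Lemma iv_res_exact0 x :
  limg (iv_can (res_l_mono 0) (res_r_mono 0) x) = lker (iv_can (leqnn a) res_aug_mono x).
Proof. by apply: iv_can_exact; rewrite /insupp /=; lia. Qed.

Lemma iv_res_exactS m x :
  limg (iv_can (res_l_mono m.+1) (res_r_mono m.+1) x)
  = lker (iv_can (res_l_mono m) (res_r_mono m) x).
Proof.
apply: iv_can_exact; move: reach2 reach_ab; rewrite /insupp.
by case: m => [|[|m]] /=; lia.
Qed.

Definition iv_res : proj_resolution (iv a b) :=
  ProjResolution iv_res_proj iv_res_aug_surj iv_res_exact0 iv_res_exactS.

Variables c d : nat.
Hypotheses (c1 : (1 <= c)%N) (cd : (c < d)%N) (dc : (d <= reach c)%N).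

(** Whether there are nonzero morphisms to [c, d) from the terms of degree 0, 1
    and 2 of the resolution of [a, b); the last of these terms may be zero. *)
Definition meets0 := (c <= a < d)%N.
Definition meets1 := (c <= b < d)%N.
Definition meets2 := (reach a < reach b)%N && (c <= reach a < d)%N.

Let Mcd := iv c d.
Let one l r x := iv_vec l r x 1.

Let supp_cd x : insupp c d x = (c <= x < d)%N.
Proof. rewrite /insupp c1 dc andbT //. Qed.

Lemma hom_zero_iv : hom_zero (iv a b) Mcd <-> (meets0 ==> meets1).
Proof.
rewrite /meets0 /meets1; split=> [hom0|/implyP m01 f x].
  apply/implyP => m0; apply/negPn/negP => nm1.
  have w_b : push (iv_vec c d a 1) b = 0.
    rewrite push_iv; [|lia|by rewrite supp_cd].
    by apply: iv_out; rewrite supp_cd.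
  have sa : insupp a b a by rewrite /insupp; lia.
  have := gen_mor_gen w_b sa; rewrite hom0 zero_lfunE => /esym/eqP.
  by apply/negP/iv_vec_neq0; rewrite ?supp_cd ?oner_eq0.
apply/lfunP => u; rewrite zero_lfunE.
suff h : forall x u, f x u = amor0 _ _ x u by rewrite h amor0E.
apply: iv_mor_eq => sa; rewrite amor0E.
have [m0|nm0] := boolP (c <= a < d)%N; last by apply: iv_out; rewrite supp_cd.
have fb : f b 0 = push (f a (one a b a)) b.
  rewrite -push_nat push_iv //; last by lia.
  by congr (f b _); apply: iv_out; rewrite /insupp; lia.
move: fb; rewrite linear0 -[f a _]iv_coefK push_iv; [|lia|by rewrite supp_cd].
move/esym/(congr1 (@iv_coef _ _ _ _ _)); rewrite iv_vecK ?supp_cd ?m01 // iv_coef0 => ->.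
exact: iv_vec0.
Qed.

Lemma iv_mor_eq0 l r (g : amor (iv l r) Mcd) x u :
  (insupp l r l -> ~~ (c <= l < d)%N) -> g x u = 0.
Proof.
move=> out; rewrite (iv_mor_eq (g := amor0 _ _)) ?amor0E // => sl.
by apply: iv_out; rewrite supp_cd out.
Qed.

Lemma iv_gen_neq0 l : (c <= l < d)%N -> iv_vec c d l 1 <> 0.
Proof. by move=> cld; apply/eqP/iv_vec_neq0; rewrite ?supp_cd ?oner_eq0. Qed.

Lemma supp_reach l : (c <= l < d)%N -> insupp l (reach l) l.
Proof. by move=> cld; rewrite /insupp; have := @reach_mono A c l; lia. Qed.

(** The one-dimensional space at b is killed if it receives a nonzero map from
    a, or if it is mapped injectively to the space at reach a. *)
Lemma ext_vanishes0 : ext_vanishes iv_res 0 Mcd <-> (meets1 ==> meets0 || meets2).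
Proof.
rewrite /meets0 /meets1 /meets2; split=> [ext0|/implyP m1 f fd0].
  apply/implyP => m1; apply/negPn/negP; rewrite negb_or => /andP[nm0 nm2].
  have w_r : push (iv_vec c d b 1) (reach b) = 0 := push_reach _.
  pose f : amor (res_obj iv_res 1) Mcd := gen_mor w_r.
  have [|g gE] := ext0 f.
    move=> x v; rewrite -amorE; apply: iv_mor_eq0.
    by move: nm2; rewrite /insupp /=; lia.
  have := gen_mor_gen w_r (supp_reach m1); rewrite -/f gE.
  by rewrite iv_mor_eq0 => // h; apply: (iv_gen_neq0 m1).
pose w := iv_coef (f b (one b (reach b) b)).
have fb : f b (one b (reach b) b) = iv_vec c d b w by rewrite iv_coefK.
have [m1t|nm1] := boolP (c <= b < d)%N; last first.
  by exists (amor0 _ _) => x v; rewrite amor0E iv_mor_eq0.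
case/orP: (m1 m1t) => [m0|/andP[EE m2]].
  have w_r : push (iv_vec c d a w) (reach a) = 0 := push_reach _.
  exists (gen_mor w_r) => x v; rewrite -[RHS]amorE; apply: iv_mor_eq => sb.
  rewrite [LHS]fb [RHS]amorE iv_canE iv_vecK // gen_morE iv_vecK.
    by rewrite scale1r push_iv // ?supp_cd // ltnW.
  by rewrite /insupp /=; have := @reach_mono A c a; lia.
have w0 : w = 0.
  have s2 : insupp (reach a) (reach b) (reach a).
    by rewrite /insupp; have := reach2 EE; lia.
  have := fd0 (reach a) (iv_vec (reach a) (reach b) (reach a) 1).
  rewrite [res_d _ _ _ _](iv_can_vec _ _ _ s2).
  rewrite iv_morE iv_vecK; last by rewrite /insupp /=; lia.
  rewrite scale1r fb push_iv ?supp_cd // => /(congr1 (@iv_coef _ _ _ _ _)).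
  by rewrite iv_vecK ?supp_cd // iv_coef0.
have f0 : forall x v, f x v = amor0 _ Mcd x v.
  by apply: iv_mor_eq => _; rewrite amor0E [LHS]fb w0 iv_vec0.
by exists (amor0 _ _) => x v; rewrite f0 !amor0E.
Qed.

Lemma ext_vanishes1 : ext_vanishes iv_res 1 Mcd <-> (meets2 ==> meets1).
Proof.
rewrite /meets1 /meets2; split=> [ext1|/implyP m2 f _].
  apply/implyP => /andP[EE m2]; apply/negPn/negP => nm1.
  have w_r : push (iv_vec c d (reach a) 1) (reach b) = 0.
    by rewrite -reach2 // push_reach.
  pose f : amor (res_obj iv_res 2) Mcd := gen_mor w_r.
  have [|g gE] := ext1 f.
    by move=> x v; rewrite -amorE; apply: iv_mor_eq0; rewrite /insupp /=; lia.
  have s2 : insupp (reach a) (reach b) (reach a).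
    by rewrite /insupp; have := reach2 EE; lia.
  have := gen_mor_gen w_r s2; rewrite -/f gE.
  by rewrite iv_mor_eq0 => // h; apply: (iv_gen_neq0 m2).
pose w := iv_coef (f (reach a) (one (reach a) (reach b) (reach a))).
have fE : f (reach a) (one (reach a) (reach b) (reach a)) = iv_vec c d (reach a) w.
  by rewrite iv_coefK.
have [m2t|nm2] := boolP ((reach a < reach b) && (c <= reach a < d))%N; last first.
  exists (amor0 _ _) => x v; rewrite amor0E iv_mor_eq0 //.
  by move: nm2; rewrite /insupp /=; lia.
have w_r : push (iv_vec c d b w) (reach b) = 0 := push_reach _.
exists (gen_mor w_r) => x v; rewrite -[RHS]amorE; apply: iv_mor_eq => s2.
rewrite [LHS]fE [RHS]amorE iv_canE iv_vecK // gen_morE iv_vecK.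
  by rewrite scale1r push_iv // supp_cd m2.
by move: s2; rewrite /insupp /=; lia.
Qed.

Lemma ext_vanishesSS m : ext_vanishes iv_res m.+2 Mcd.
Proof.
move=> f _; exists (amor0 _ _) => x v; rewrite amor0E iv_mor_eq0 //.
by rewrite /insupp /=; lia.
Qed.

(** Exactness of the complex F^[meets0] -> F^[meets1] -> F^[meets2] -> 0. *)
Definition exceptional_iv :=
  [&& meets0 ==> meets1, meets1 ==> meets0 || meets2 & meets2 ==> meets1].

Lemma exceptional_pair_iv : exceptional_pair Mcd (iv a b) <-> exceptional_iv.
Proof.
rewrite /exceptional_pair hom_zero_iv /exceptional_iv.
split=> [[m0 ext]|/and3P[m0 m1 m2]].
  have ext' m := (extS_zeroP m Mcd iv_res).1 (ext m).
  by rewrite m0 (ext_vanishes0.1 (ext' 0%N)) (ext_vanishes1.1 (ext' 1%N)).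
split=> // -[|[|m]]; apply/(extS_zeroP _ _ iv_res).
- exact/ext_vanishes0.
- exact/ext_vanishes1.
exact: ext_vanishesSS.
Qed.

End Resolution.
End IntervalExt.

(** * Classification of the indecomposable modules *)

Section Classification.
Variables (F : fieldType) (A : bound_quiver).
Implicit Types (M N : amod F A).
Local Notation reach := (reach A).
Local Notation insupp := (insupp A).
Local Notation iv := (iv F A).
Local Notation iv_vec := (@iv_vec F A).

Definition iv_wf l r := [&& (1 <= l)%N, (l < r)%N & (r <= reach l)%N].

Lemma iv_wf_supp l r x : iv_wf l r -> insupp l r x = (l <= x < r)%N.
Proof. by case/and3P=> l1 _ rl; rewrite /insupp l1 rl andbT. Qed.

Lemma iv_not_azero l r : iv_wf l r -> ~ azero (iv l r).
Proof.
move=> wf /(_ l); rewrite iv_dim iv_wf_supp // leqnn.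
by case/and3P: wf => _ -> _.
Qed.

Lemma dim_aiso M N x : aiso M N -> \dim {: M x} = \dim {: N x}.
Proof.
have le (M' N' : amod F A) : aiso M' N' -> (\dim {: M' x} <= \dim {: N' x})%N.
  case/aisoP=> f [g [gf _]].
  have f_inj : (lker (f x) == 0)%VS.
    by apply/lker0P => u v /(congr1 (g x)); rewrite !gf.
  by rewrite -(limg_dim_eq (f := f x)) ?dimvS ?subvf // (eqP f_inj) capv0.
by move=> iMN; apply/eqP; rewrite eqn_leq !le //; apply: aiso_sym.
Qed.

Lemma iv_aiso_inj l r l' r' : iv_wf l r -> iv_wf l' r' ->
  aiso (iv l r) (iv l' r') -> l = l' /\ r = r'.
Proof.
move=> wf wf' iso.
have supE x : (l <= x < r)%N = (l' <= x < r')%N.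
  have := dim_aiso x iso; rewrite !iv_dim !iv_wf_supp //.
  by case: (_ && _); case: (_ && _).
have [/and3P[_ lr _] /and3P[_ lr' _]] := (wf, wf').
have := supE l; have := supE l'; have := supE r.-1; have := supE r'.-1; lia.
Qed.

Lemma iv_end l r (e : amor (iv l r) (iv l r)) :
  exists c : F, forall x u, e x u = c *: u.
Proof.
exists (iv_coef (e l (iv_vec l r l 1))) => x u.
have [sx|nsx] := boolP (insupp l r x); last exact: iv_out.
have [lx sl] : (l <= x)%N /\ insupp l r l by move: sx; rewrite /insupp; lia.
rewrite iv_morE -{1}[e l _]iv_coefK push_iv // [in RHS](_ : u = iv_vec l r x (iv_coef u)).
  set k := iv_coef (e _ _).
  by rewrite [iv_vec l r x k]iv_vecE [iv_vec l r x (iv_coef u)]iv_vecE !scalerA mulrC.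
by rewrite iv_coefK.
Qed.

(** Endomorphisms of an interval module are scalars, and the projection onto a
    summand is an idempotent one, hence 0 or 1. *)
Lemma iv_indecomposable l r : iv_wf l r -> indecomposable (iv l r).
Proof.
move=> wf; split=> [|U W /aisoP[f [g [gf fg]]]]; first exact: iv_not_azero.
pose p x (w : dsum U W x) : dsum U W x := (w.1, 0).
have pl x : linear (@p x).
  by move=> c u v; rewrite /p; congr (_, _); rewrite /= scaler0 addr0.
have mpD x (w : dsum U W x) : mp (dsum U W) x w = (mp U x w.1, mp W x w.2).
  exact: pair_homE.
have pc x v : mp (dsum U W) x (linfun (@p x) v) = linfun (@p x.+1) (mp (dsum U W) x v).
  by rewrite !(linfun_eval (@pl _)) !mpD /p /= linear0.
pose pm : amor (dsum U W) (dsum U W) := AMor (amor_of_eval pc).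
(* The idempotent p of U + W, seen as an endomorphism of the interval module. *)
have [c eE] := iv_end (amor_comp g (amor_comp pm f)).
have pmE x w : pm x w = (w.1, 0) by exact: (linfun_eval (@pl _)).
have pmc x w : pm x w = c *: w.
  by have := eE x (g x w); rewrite !amorE fg => /(congr1 (f x)); rewrite linearZ /= !fg.
have [c0|c0] := eqVneq c 0.
  left=> x; apply/eqP; rewrite dimv_eq0; apply/eqP/vspaceP => u.
  rewrite memvf memv0; have := pmc x (u, 0); rewrite pmE c0 scale0r => -[->].
  by rewrite eqxx.
right=> x; apply/eqP; rewrite dimv_eq0; apply/eqP/vspaceP => w.
rewrite memvf memv0; have := pmc x (0, w); rewrite pmE => -[_ /esym/eqP].
by rewrite scaler_eq0 (negPf c0) /= => ->.
Qed.

Lemma indecomposable_iv M : indecomposable M ->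
  exists l r, iv_wf l r /\ aiso M (iv l r).
Proof.
move=> indM; have [Mn0 _] := indM.
pose P x := \dim {: M x} != 0%N.
have exP : exists x, P x.
  have [|none] := boolP [exists x : 'I_(nvert A).+1, P x].
    by case/existsP=> x Px; exists x.
  case: Mn0 => x; have [xn|xn] := leqP x (nvert A); last first.
    by apply: sp_supp; rewrite (leqNgt x) xn andbF.
  by move/existsPn: none => /(_ (Ordinal (xn : (x < (nvert A).+1)%N)))/negPn/eqP.
case: (ex_minnP exP) => l Pl lmin.
have M0 x (u : M x) : (x < l)%N -> u = 0.
  move=> xl; apply: dim0_eq0; apply/eqP/negPn/negP => /lmin.
  by rewrite leqNgt xl.
have ln : (1 <= l <= nvert A)%N.
  by apply/negPn/negP => /(sp_supp M) l0; move: Pl; rewrite /P l0.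
pose v := vpick {: M l}.
have v0 : v != 0 by rewrite vpick0 -dimv_eq0.
pose Q x := (l <= x)%N && (push v x == 0).
have lreach : (l <= reach l)%N.
  by have [->|[j [_ lj ->]]] := reachP A l; lia.
have exQ : exists x, Q x by exists (reach l); rewrite /Q lreach push_reach /=.
case: (ex_minnP exQ) => r /andP[lr /eqP vr0] rmin.
have {}lr : (l < r)%N.
  by rewrite ltn_neqAle lr andbT; apply: contraNneq v0 => e; move: vr0; rewrite -e push_id => ->.
have wf : iv_wf l r.
  by rewrite /iv_wf lr /= rmin ?andbT //; [case/andP: ln | rewrite /Q lreach push_reach /=].
have v_n0 x : (l <= x < r)%N -> push v x != 0.
  by move=> lxr; apply/negP => vx0; have := rmin x; rewrite /Q vx0; lia.
(* phi x takes the value 1 on the image of v at x; lam pulls phi back from the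
   last vertex r.-1, by recursion on the distance to r.-1. *)
pose co x : M x -> F^o := coord [tuple push v x] ord0.
have col x : linear (co x) by move=> c u w; rewrite /co linearD linearZ.
pose phi x : 'Hom(M x, F^o) := linfun (co x).
have phiE x : (l <= x < r)%N -> phi x (push v x) = 1.
  move=> /v_n0 tx; rewrite (linfun_eval (@col _)).
  have fr : free [tuple push v x] by rewrite seq1_free.
  exact: (coord_free ord0 ord0 fr).
pose back := fix back (m : nat) (x : nat) : 'Hom(M x, F^o) :=
  match m with 0 => phi x | m'.+1 => (back m' x.+1 \o mp M x)%VF end.
pose lam x := back (r.-1 - x)%N x.
have lamS x u : (x.+1 < r)%N -> lam x u = lam x.+1 (mp M x u).
  move=> xr; rewrite /lam (_ : r.-1 - x = (r.-1 - x.+1).+1)%N; last by lia.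
  exact: comp_lfunE.
have lamv x : (l <= x < r)%N -> lam x (push v x) = 1.
  move=> lxr; rewrite -[x](subKn (n := r.-1)); last by lia.
  have : (r.-1 - x <= r.-1 - l)%N by lia.
  elim: (_ - x)%N => [|m IHm] hm.
    rewrite subn0 /lam subnn; apply: phiE; lia.
  rewrite lamS; last by lia.
  rewrite -pushS; last by lia.
  have -> : (r.-1 - m.+1).+1 = (r.-1 - m)%N by lia.
  by apply: IHm; lia.
have pl x : linear (fun u : M x => iv_vec l r x (lam x u)).
  by move=> c u w; rewrite linearP iv_vec_linear.
have pc x u : mp (iv l r) x (linfun (fun u : M x => iv_vec l r x (lam x u)) u)
   = linfun (fun u : M x.+1 => iv_vec l r x.+1 (lam x.+1 u)) (mp M x u).
  rewrite !(linfun_eval (@pl _)) mp_iv.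
  have [sx'|nsx'] := boolP (insupp l r x.+1); last exact: iv_out.
  have [xr] : (x.+1 < r)%N by case/and4P: sx'.
  have [sx|] := boolP (insupp l r x); first by rewrite iv_vecK // lamS.
  rewrite iv_wf_supp // => nsx.
  by rewrite (M0 x u) ?linear0 ?iv_coef0 ?iv_vec0 //; lia.
pose p : amor M (iv l r) := AMor (amor_of_eval pc).
have pE x u : p x u = iv_vec l r x (lam x u) by exact: (linfun_eval (@pl _)).
exists l, r; split=> //.
apply: (retract_split (s := gen_mor vr0) (r := p)) => //; last exact: iv_not_azero.
move=> x u; have [sx|nsx] := boolP (insupp l r x); last exact: iv_out.
rewrite gen_morE pE linearZ /= lamv -?iv_wf_supp //.
by rewrite -[RHS]iv_coefK; congr (iv_vec _ _ _ _); exact: mulr1.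
Qed.
End Classification.

Section Counting.
Variables (F : fieldType) (A : bound_quiver).
Local Notation reach := (reach A).

(** The quadruple stands for the pair (M, N) with M = [c, d) and N = [a, b). *)
Definition exc_quad a b c d :=
  [&& iv_wf A a b, iv_wf A c d & exceptional_iv A a b c d].

Lemma num_exceptional_pairs_iv :
  (forall a b, (1 <= a)%N -> (a < b)%N -> (b <= reach a)%N ->
     (reach a < reach b)%N -> reach (reach a) = reach b) ->
  num_exceptional_pairs F A
    (\sum_(1 <= a < (nvert A).+2) \sum_(1 <= b < (nvert A).+2)
     \sum_(1 <= c < (nvert A).+2) \sum_(1 <= d < (nvert A).+2)
       exc_quad a b c d)%N.
Proof.
move=> reach2; set m := (nvert A).+2.
pose T := ('I_m * 'I_m * ('I_m * 'I_m))%type.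
pose P (t : T) := exc_quad t.1.1 t.1.2 t.2.1 t.2.2.
have wf_lt l r : iv_wf A l r -> (l < m)%N /\ (r < m)%N.
  by case/and3P=> _ lr rl; have := reach_le A l; lia.
have wfP l r : iv_wf A l r -> [/\ (1 <= l)%N, (l < r)%N & (r <= reach l)%N].
  by move/and3P.
set S := (\sum_(1 <= a < m) _)%N.
have -> : S = #|P|.
  have drop0 (f : nat -> nat) : f 0%N = 0%N ->
      (\sum_(1 <= x < m) f x = \sum_(x < m) f x)%N.
    by move=> f0; rewrite -(big_mkord xpredT) [RHS]big_ltn // f0.
  have nwf0 l : ~~ iv_wf A l 0 by rewrite /iv_wf ltn0 andbF.
  have nwf0' r : ~~ iv_wf A 0 r by [].
  rewrite -sum1_card [RHS]big_mkcond /= /S.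
  rewrite -(pair_bigA _ (fun ab cd => if (ab, cd) \in P then 1 else 0)%N) /=.
  rewrite -(pair_bigA _ (fun a b => \sum_cd if (a, b, cd) \in P then 1 else 0)%N) /=.
  rewrite drop0; last first.
    by rewrite !big1 // => b _; rewrite !big1 // => c _; rewrite !big1.
  apply: eq_bigr => a _; rewrite drop0; last first.
    by rewrite !big1 // => c _; rewrite !big1 // => d _; rewrite /exc_quad (negPf (nwf0 _)).
  apply: eq_bigr => b _.
  rewrite -(pair_bigA _ (fun c d => if (a, b, (c, d)) \in P then 1 else 0)%N) /=.
  rewrite drop0; last by rewrite !big1 // => d _; rewrite /exc_quad andbF.
  apply: eq_bigr => c _; rewrite drop0; last first.
    by rewrite /exc_quad (negPf (nwf0 _)) andbF.
  by apply: eq_bigr => d _; rewrite unfold_in /P /=; case: exc_quad.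
pose rep (q : 'I_#|P|) : amod F A * amod F A :=
  let t := @enum_val T P q in (iv F A t.2.1 t.2.2, iv F A t.1.1 t.1.2).
have repP q : P (@enum_val T P q) by exact: (@enum_valP T P q).
exists rep; split.
- move=> q; have /and3P[wab wcd exc] := repP q.
  have [[a1 ab ba] [c1 cd dc]] := (wfP _ _ wab, wfP _ _ wcd).
  split; [exact: iv_indecomposable | exact: iv_indecomposable |].
  by apply/exceptional_pair_iv => //; apply: reach2.
- move=> q q' [iso1 iso2]; apply: enum_val_inj.
  have [/and3P[wab wcd _] /and3P[wab' wcd' _]] := (repP q, repP q').
  have [/val_inj e1 /val_inj e2] := iv_aiso_inj wcd wcd' iso1.
  have [/val_inj e3 /val_inj e4] := iv_aiso_inj wab wab' iso2.
  by rewrite [LHS]surjective_pairing [RHS]surjective_pairing; congr (_, _);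
     rewrite [LHS]surjective_pairing [RHS]surjective_pairing; congr (_, _).
case=> M N /= [indM indN exc].
have [c [d [wcd isoM]]] := indecomposable_iv indM.
have [a [b [wab isoN]]] := indecomposable_iv indN.
have [[am bm] [cm dm]] := (wf_lt _ _ wab, wf_lt _ _ wcd).
have Pt : P (Ordinal am, Ordinal bm, (Ordinal cm, Ordinal dm)).
  rewrite /P /exc_quad wab wcd /=.
  have [[a1 ab ba] [c1 cd dc]] := (wfP _ _ wab, wfP _ _ wcd).
  apply/(@exceptional_pair_iv F) => //; first exact: reach2.
  exact: exceptional_iso isoM isoN exc.
exists (enum_rank_in Pt (Ordinal am, Ordinal bm, (Ordinal cm, Ordinal dm))).
by rewrite /rep enum_rankK_in.
Qed.

End Counting.

(** * Sums over intervals and blocks *)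

(** Turns a sum with an interval constraint in its summand into a sum over that
    interval; this is how the indicator functions of quadruples are summed. *)
Lemma sum_restrict (M lo hi : nat) (f : nat -> nat) : (1 <= lo)%N -> (hi <= M)%N ->
  (\sum_(1 <= z < M) (lo <= z < hi) * f z = \sum_(lo <= z < hi) f z)%N.
Proof.
move=> lo1 hiM.
have out z : ~~ (lo <= z < hi)%N -> ((lo <= z < hi) * f z = 0)%N by move=> /negPf ->.
have [lohi|hilo] := leqP lo hi; last first.
  rewrite [RHS]big_geq; last exact: ltnW.
  apply: big1 => z _; apply: out; lia.
rewrite (big_cat_nat lo1) /=; last exact: leq_trans hiM.
rewrite (big_cat_nat lohi hiM) /= big_nat big1 => [|z hz]; last by apply: out; lia.
rewrite add0n [X in (_ + X)%N]big_nat [X in (_ + X)%N]big1 ?addn0 => [|z hz].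
  by apply: eq_big_nat => z hz; rewrite hz mul1n.
by apply: out; lia.
Qed.

Lemma sum_restrict1 (M lo hi : nat) : (1 <= lo)%N -> (hi <= M)%N ->
  (\sum_(1 <= z < M) (lo <= z < hi) = hi - lo)%N.
Proof.
move=> lo1 hiM; rewrite -[RHS]muln1 -sum_nat_const_nat -(sum_restrict _ lo1 hiM).
by apply: eq_bigr => z _; rewrite muln1.
Qed.

Lemma block_cover (i : nat -> nat) k x : i 0%N = 0%N ->
  (1 <= x <= i k)%N -> exists2 j, (1 <= j <= k)%N & (i j.-1 < x <= i j)%N.
Proof.
move=> i0; elim: k => [|k IHk] hx; first by rewrite i0 in hx; lia.
have [xk|kx] := leqP x (i k); last by exists k.+1 => //=; lia.
by have [|j hj xj] := IHk; [lia | exists j => //; lia].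
Qed.

Lemma sum_block (R : nmodType) (i : nat -> nat) k (f : nat -> R) :
  i 0%N = 0%N -> (forall j, (j < k)%N -> (i j <= i j.+1)%N) ->
  \sum_(1 <= x < (i k).+1) f x
  = \sum_(1 <= j < k.+1) \sum_((i j.-1).+1 <= x < (i j).+1) f x.
Proof.
move=> i0; elim: k => [|k IHk] imono; first by rewrite i0 !big_geq.
rewrite [RHS]big_nat_recr //= (big_cat_nat (n := (i k).+1)) //=; last first.
  by rewrite ltnS imono.
by rewrite IHk // => j jk; apply: imono; exact: ltnW.
Qed.

Lemma sum_telescope (f G : nat -> rat) a b : (a <= b)%N ->
  (forall z, (a <= z < b)%N -> f z = G z.+1 - G z) ->
  \sum_(a <= z < b) f z = G b - G a.
Proof. by move=> ab fG; rewrite (eq_big_nat _ _ fG) telescope_sumr. Qed.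

Lemma sum_sub_telescope (V a b : nat) : (a <= b)%N -> (b <= V.+1)%N ->
  (\sum_(a <= d < b) (V - d))%N%:R =
  ((V%:R - a%:R) * (V%:R - a%:R + 1) - (V%:R - b%:R) * (V%:R - b%:R + 1)) / 2%:R :> rat.
Proof.
move=> ab bV; rewrite natr_sum.
rewrite (sum_telescope (G := fun d => - ((V%:R - d%:R) * (V%:R - d%:R + 1)) / 2%:R)) //.
  by field.
move=> d dab; rewrite natrB; last by lia.
by rewrite -natr1; field.
Qed.

Lemma sum_nat_diff (f : nat -> rat) k :
  \sum_(1 <= j < k.+1) (f j - f j.-1) = f k - f 0%N.
Proof. by rewrite big_add1 telescope_sumr. Qed.

Lemma bin2R N : 'C(N, 2)%:R = N%:R * (N%:R - 1) / 2%:R :> rat.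
Proof.
elim: N => [|N IH]; first by rewrite bin0n /=; field.
by rewrite binS natrD IH bin1 -natr1; field.
Qed.

Lemma bin3R N : 'C(N, 3)%:R = N%:R * (N%:R - 1) * (N%:R - 2%:R) / 6%:R :> rat.
Proof.
elim: N => [|N IH]; first by rewrite bin0n /=; field.
by rewrite binS natrD IH bin2R -natr1; field.
Qed.

Lemma bin4R N :
  'C(N, 4)%:R = N%:R * (N%:R - 1) * (N%:R - 2%:R) * (N%:R - 3%:R) / 24%:R :> rat.
Proof.
elim: N => [|N IH]; first by rewrite bin0n /=; field.
by rewrite binS natrD IH bin3R -natr1; field.
Qed.

Lemma triR N : (tri N)%:R = N%:R * (N%:R + 1) / 2%:R :> rat.
Proof. by rewrite /tri -[(N * N.+1)%N]/(N.+1.-1 * N.+1)%N mulnC -bin2 bin2R -natr1; field. Qed.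

(** * Counting the pairs that are not exceptional *)

(** The pairs with Hom nonzero and M starting at x, followed by those with Ext^1,
    respectively Ext^2, nonzero and N starting at x. *)
Definition nonexc_from (E : nat -> nat) x : nat :=
  (\sum_(x <= a < E x) \sum_(a.+1 <= d < (E x).+1) ((E a).+1 - d)
        + \sum_(x.+1 <= b < E x) (b - x) * (E x - b)
        + \sum_(x.+1 <= b < E x)
           (E x < E b) * \sum_(b.+1 <= c < (E x).+1) (E c - E x))%N.

Section Count.
Variable A : bound_quiver.
Local Notation reach := (reach A).
Local Notation n := (nvert A).
Local Notation m := n.+2.

(** Let M = [c, d) and N = [a, b).  In the three cases below exactly one of
    a, b, reach a contributes to the complex that computes Ext(N, M): the point
    a for Hom, b for Ext^1 and reach a for Ext^2. *)
Definition hom_quad a b c d := [&& c <= a, a < d, d <= b, b <= reach a & d <= reach c]%N.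
Definition ext1_quad a b c d := [&& a < c, c <= b, b < d & d <= reach a]%N.
Definition ext2_quad a b c d :=
  [&& a < b, reach a < reach b, b < c, c <= reach a, reach a < d & d <= reach c]%N.

(** At most two of a, b, reach a can contribute, since [c, d) cannot contain both
    a and reach a.  So a pair that is not exceptional falls under exactly one of
    the three cases.  In the case of b the condition that reach a does not
    contribute amounts to d <= reach a, by monotonicity of reach. *)
Lemma exc_quadN a b c d : (1 <= a)%N -> (1 <= c)%N ->
  (iv_wf A a b * iv_wf A c d
   = exc_quad A a b c d + (hom_quad a b c d + ext1_quad a b c d + ext2_quad a b c d))%N.
Proof.
move=> a1 c1.
have := reach_mono A (l := a) (l' := b); have := reach_mono A (l := a) (l' := c).
have := reach_mono A (l := c) (l' := a); have := reach_mono A (l := b) (l' := c).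
have := reach_mono A (l := c) (l' := b).
rewrite /exc_quad /exceptional_iv /meets0 /meets1 /meets2 /iv_wf.
rewrite /hom_quad /ext1_quad /ext2_quad.
move: (reach a) (reach b) (reach c) => Ea Eb Ec.
have [ab|ba] := ltnP a b; have [ac|ca] := ltnP a c; have [bc|cb] := ltnP b c.
all: rewrite /= ?andbF ?andbT /=.
all: lia.
Qed.

Lemma reachS_le x : ((reach x).+1 <= m)%N.
Proof. exact: reach_le. Qed.

Lemma sum_wf a : (1 <= a)%N ->
  (\sum_(1 <= b < m) iv_wf A a b = reach a - a)%N.
Proof.
move=> a1; rewrite -subSS -(sum_restrict1 _ (reachS_le a)) //.
by apply: eq_bigr => b _; rewrite /iv_wf a1.
Qed.

Lemma sum_hom c : (1 <= c)%N ->
  (\sum_(1 <= a < m) \sum_(1 <= b < m) \sum_(1 <= d < m) hom_quad a b c d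
   = \sum_(c <= a < reach c) \sum_(a.+1 <= d < (reach c).+1) ((reach a).+1 - d))%N.
Proof.
move=> c1; rewrite -(@sum_restrict m c) ?(ltnW (reachS_le c)) //.
apply: eq_big_nat => a /andP[a1 _]; rewrite exchange_big /=.
have [ca|ac] /= := leqP c a; last first.
  rewrite mul0n big1 // => d _; rewrite big1 // => b _.
  by rewrite /hom_quad leqNgt ac.
have [aE|Ea] /= := ltnP a (reach c); last first.
  rewrite mul0n big1 // => d _; rewrite big1 // => b _.
  by rewrite /hom_quad; lia.
rewrite mul1n -(sum_restrict _ _ (reachS_le c)) //.
apply: eq_big_nat => d /andP[d1 _].
rewrite -(sum_restrict1 d1 (reachS_le a)) big_distrr /=.
by apply: eq_bigr => b _; rewrite mulnb /hom_quad ca /=; congr nat_of_bool; lia.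
Qed.

Lemma sum_ext1 a : (1 <= a)%N ->
  (\sum_(1 <= b < m) \sum_(1 <= c < m) \sum_(1 <= d < m) ext1_quad a b c d
   = \sum_(a.+1 <= b < reach a) (b - a) * (reach a - b))%N.
Proof.
move=> a1; rewrite -(sum_restrict _ _ (ltnW (reachS_le a))) //.
apply: eq_big_nat => b /andP[b1 bm].
rewrite -subSS -(@sum_restrict1 m a.+1 b.+1) // -[(reach a - b)%N]subSS.
rewrite -(@sum_restrict1 m b.+1 (reach a).+1) ?reachS_le // big_distrl /= big_distrr /=.
apply: eq_bigr => c _; rewrite !big_distrr /=; apply: eq_bigr => d _.
by rewrite !mulnb /ext1_quad; congr nat_of_bool; lia.
Qed.

Lemma sum_ext2 a : (1 <= a)%N ->
  (\sum_(1 <= b < m) \sum_(1 <= c < m) \sum_(1 <= d < m) ext2_quad a b c d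
   = \sum_(a.+1 <= b < reach a)
       (reach a < reach b) * \sum_(b.+1 <= c < (reach a).+1) (reach c - reach a))%N.
Proof.
move=> a1; rewrite -(sum_restrict _ _ (ltnW (reachS_le a))) //.
apply: eq_big_nat => b /andP[b1 bm].
rewrite -(sum_restrict _ _ (reachS_le a)) // mulnA big_distrr /=.
apply: eq_bigr => c _; rewrite -subSS -(sum_restrict1 _ (reachS_le c)) //.
rewrite mulnA big_distrr /=; apply: eq_bigr => d _.
by rewrite !mulnb /ext2_quad; congr nat_of_bool; lia.
Qed.

(** The left-hand side is the square of the number of interval modules. *)
Lemma sum_exc_quad :
  ((\sum_(1 <= a < m) (reach a - a)) ^ 2 =
   \sum_(1 <= a < m) \sum_(1 <= b < m) \sum_(1 <= c < m) \sum_(1 <= d < m)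
     exc_quad A a b c d
   + \sum_(1 <= x < m) nonexc_from reach x)%N.
Proof.
have -> : (\sum_(1 <= a < m) (reach a - a)
           = \sum_(1 <= a < m) \sum_(1 <= b < m) iv_wf A a b)%N.
  by apply: eq_big_nat => a /andP[a1 _]; rewrite sum_wf.
rewrite -mulnn big_distrl /=.
transitivity (\sum_(1 <= a < m) \sum_(1 <= b < m) \sum_(1 <= c < m) \sum_(1 <= d < m)
   (exc_quad A a b c d + (hom_quad a b c d + ext1_quad a b c d + ext2_quad a b c d)))%N.
  apply: eq_big_nat => a /andP[a1 _]; rewrite big_distrl /=.
  apply: eq_big_nat => b _; rewrite big_distrr /=.
  apply: eq_big_nat => c /andP[c1 _]; rewrite big_distrr /=.
  by apply: eq_big_nat => d _; rewrite exc_quadN.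
have split4 (f g : nat -> nat -> nat -> nat -> nat) :
  (\sum_(1 <= a < m) \sum_(1 <= b < m) \sum_(1 <= c < m) \sum_(1 <= d < m)
      (f a b c d + g a b c d)
   = \sum_(1 <= a < m) \sum_(1 <= b < m) \sum_(1 <= c < m) \sum_(1 <= d < m) f a b c d
   + \sum_(1 <= a < m) \sum_(1 <= b < m) \sum_(1 <= c < m) \sum_(1 <= d < m) g a b c d)%N.
  rewrite -big_split; apply: eq_bigr => a _; rewrite -big_split; apply: eq_bigr => b _.
  by rewrite -big_split; apply: eq_bigr => c _; rewrite -big_split.
rewrite !split4 /nonexc_from !big_split /=; congr (_ + (_ + _ + _))%N.
- rewrite [RHS](eq_big_nat _ _ (F2 := fun c =>
    \sum_(1 <= a < m) \sum_(1 <= b < m) \sum_(1 <= d < m) hom_quad a b c d)%N);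
    last by move=> c /andP[c1 _]; rewrite sum_hom.
  by rewrite [RHS]exchange_big /=; apply: eq_bigr => a _; rewrite [RHS]exchange_big.
- by apply: eq_big_nat => a /andP[a1 _]; rewrite sum_ext1.
by apply: eq_big_nat => a /andP[a1 _]; rewrite sum_ext2.
Qed.

End Count.

(** * Evaluation on blocks *)

(** In this section lo, hi and p stand for i_(j-1), i_j and p_j, and E' for the
    value of reach on the block that follows. *)
Section Block.
Variables (E : nat -> nat) (lo hi p : nat).
Hypothesis lohi : (lo <= hi)%N.
Hypothesis E_in : forall x, (lo < x <= hi)%N -> E x = (hi + p).+1.

Lemma sum_E_sub :
  (\sum_(lo.+1 <= x < hi.+1) (E x - x))%N%:R =
    (hi - lo)%N%:R * (hi + p)%N%:R
    - (hi%:R * (hi%:R - 1) / 2%:R - lo%:R * (lo%:R - 1) / 2%:R) :> rat.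
Proof.
rewrite (eq_big_nat _ _ (F2 := fun x => (hi + p).+1 - x)%N); last first.
  by move=> x hx; rewrite E_in.
rewrite sum_sub_telescope; [|lia|lia].
by rewrite -!natr1 natrB // natrD; field.
Qed.

Variable E' : nat.
Hypothesis EE' : (hi + p < E')%N.
Hypothesis E_next : forall x, (hi < x <= (hi + p).+1)%N -> E x = E'.

(** With D = E' - E x, where E x = hi + p + 1, the Hom term is
    C(s+2, 3) + D t_p, the Ext^1 term C(s+1, 3) and the Ext^2 term D t_p.  Only
    the p vertices between hi and E x see the value E'.  Each sum is evaluated
    by exhibiting a discrete antiderivative G of its summand. *)
Lemma nonexc_fromE x : (lo < x <= hi)%N ->
  let s : rat := hi%:R + p%:R + 1 - x%:R in
  (nonexc_from E x)%:R = s * (s + 1) * (2%:R * s + 1) / 6%:R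
    + p%:R * (p%:R + 1) * (E'%:R - (hi%:R + p%:R + 1)).
Proof.
move=> hx s; rewrite /nonexc_from E_in //; set T := (hi + p).+1.
have TR : T%:R = hi%:R + p%:R + 1 :> rat by rewrite /T -natr1 natrD.
have homE : (\sum_(x <= a < T) \sum_(a.+1 <= d < T.+1) ((E a).+1 - d))%N%:R
    = s * (s + 1) * (s + 2%:R) / 6%:R
      + p%:R * (p%:R + 1) / 2%:R * (E'%:R - T%:R) :> rat.
  rewrite natr_sum.
  have inner V a : (a < T)%N -> (T <= V)%N ->
      (\sum_(a.+1 <= d < T.+1) (V.+1 - d))%N%:R =
      ((V%:R - a%:R) * (V%:R - a%:R + 1) - (V%:R - T%:R) * (V%:R - T%:R + 1)) / 2%:R :> rat.
    move=> aT TV; rewrite sum_sub_telescope; [|lia|lia].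
    by rewrite -(natr1 V) -(natr1 a) -(natr1 T); field.
  rewrite (big_cat_nat (n := hi.+1)) /=; [|lia|lia].
  rewrite (eq_big_nat _ _ (F2 := fun a : nat => (T%:R - a%:R) * (T%:R - a%:R + 1) / 2%:R)); last first.
    by move=> a ha; rewrite E_in -/T ?inner; [field|lia|lia|lia].
  rewrite (sum_telescope (G := fun a : nat =>
    - ((T%:R - a%:R) * (T%:R - a%:R + 1) * (T%:R - a%:R + 2%:R)) / 6%:R)); [|lia|]; last first.
    by move=> a _; rewrite -natr1; field.
  rewrite (eq_big_nat _ _ (F2 := fun a : nat =>
    ((E'%:R - a%:R) * (E'%:R - a%:R + 1)
     - (E'%:R - T%:R) * (E'%:R - T%:R + 1)) / 2%:R)); last first.
    by move=> a ha; rewrite E_next ?inner; [field|lia|lia|lia].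
  rewrite (sum_telescope (G := fun a : nat =>
    - ((E'%:R - a%:R) * (E'%:R - a%:R + 1) * (E'%:R - a%:R + 2%:R)) / 6%:R
    - a%:R * ((E'%:R - T%:R) * (E'%:R - T%:R + 1)) / 2%:R)); [|lia|]; last first.
    by move=> a _; rewrite -natr1; field.
  by rewrite -(natr1 hi) !TR /s; field.
have ext1E : (\sum_(x.+1 <= b < T) (b - x) * (T - b))%N%:R
    = (s - 1) * s * (s + 1) / 6%:R :> rat.
  rewrite natr_sum.
  rewrite (sum_telescope (G := fun b : nat =>
     (T%:R - x%:R) * (b%:R - x%:R) * (b%:R - x%:R - 1) / 2%:R
     - (b%:R - x%:R) * (b%:R - x%:R - 1) * (2%:R * (b%:R - x%:R) - 1) / 6%:R)); [|lia|].
    by rewrite -(natr1 x) TR /s; field.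
  move=> b hb; rewrite natrM !natrB; [|lia|lia].
  by rewrite -natr1; field.
have ext2E : (\sum_(x.+1 <= b < T) (T < E b) * \sum_(b.+1 <= c < T.+1) (E c - T))%N%:R
    = p%:R * (p%:R + 1) / 2%:R * (E'%:R - T%:R) :> rat.
  rewrite (big_cat_nat (n := hi.+1)) /=; [|lia|lia].
  rewrite big_nat big1 ?add0n => [|b hb]; last first.
    by rewrite E_in ?ltnn //; lia.
  rewrite natr_sum (eq_big_nat _ _ (F2 := fun b : nat => (T%:R - b%:R) * (E'%:R - T%:R))); last first.
    move=> b hb; rewrite E_next; last by lia.
    rewrite (eq_big_nat _ _ (F2 := fun => (E' - T)%N)); last first.
      by move=> c hc; rewrite E_next //; lia.
    rewrite sum_nat_const_nat subSS -natrB; last by lia.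
    rewrite -natrB; last by lia.
    rewrite -natrM; congr (_%:R); case: ltnP => [|h]; first by rewrite mul1n.
    by rewrite (_ : E' - T = 0)%N ?muln0 //; lia.
  rewrite (sum_telescope (G := fun b : nat =>
    - ((T%:R - b%:R) * (T%:R - b%:R + 1)) / 2%:R * (E'%:R - T%:R))); [|lia|].
    by rewrite -(natr1 hi) !TR; field.
  by move=> b _; rewrite -natr1; field.
by rewrite !natrD homE ext1E ext2E !TR; field.
Qed.

Lemma sum_nonexc_from :
  let L : rat := (hi - lo)%N%:R in
  (\sum_(lo.+1 <= x < hi.+1) nonexc_from E x)%N%:R =
    'C(hi - lo + 3, 4)%:R + 'C(hi - lo + 2, 4)%:R
    + p%:R * ('C(hi - lo + 2, 3)%:R + 'C(hi - lo + 1, 3)%:R)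
    + L ^+ 2 * (tri p)%:R
    + 2%:R * L * (tri p)%:R
      * (E'%:R - (hi%:R + p%:R + 1) + (p%:R + 2%:R) / 3%:R).
Proof.
move=> L; rewrite natr_sum.
pose s (x : nat) : rat := hi%:R + p%:R + 1 - x%:R.
rewrite (eq_big_nat _ _ (F2 := fun x => s x * (s x + 1) * (2%:R * s x + 1) / 6%:R
    + p%:R * (p%:R + 1) * (E'%:R - (hi%:R + p%:R + 1)))); last first.
  by move=> x hx; rewrite nonexc_fromE.
rewrite (sum_telescope (G := fun x : nat =>
  - (s x * (s x + 1) * (s x + 1) * (s x + 2%:R)) / 12%:R
  + x%:R * (p%:R * (p%:R + 1) * (E'%:R - (hi%:R + p%:R + 1))))); [|by []|]; last first.
  by move=> x _; rewrite /s -natr1; field.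
rewrite triR !bin4R !bin3R !natrD -/L /s -!natr1.
have -> : hi%:R = lo%:R + L by rewrite -natrD subnKC.
by field.
Qed.

End Block.

Section OverlapFree.
Variables (n k : nat) (i p : nat -> nat).
Let A := BoundQuiver n k i p.
Hypotheses (hwf : relations_wf A) (hof : overlap_free A).
Hypothesis hik : i k.+1 = n.

Lemma i_step j : (1 <= j <= k)%N -> (i j + p j < i j.+1)%N.
Proof.
move=> hj; have [rel mono] := hwf; have [i1 p1 pn] := rel j hj.
have [jk|kj] := ltnP j k; last first.
  by move: pn => /=; rewrite (_ : j = k) ?hik; lia.
rewrite ltnNge; apply/negP => le.
have := mono j; rewrite /= => /(_ _) lt.
have : j = j.+1; last by lia.
by apply: (hof (a := i j.+1)); rewrite /arrow_in /=; lia.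
Qed.

Hypothesis hi0 : i 0%N = 0%N.

Lemma i_mono j : (j <= k)%N -> (i j <= i j.+1)%N.
Proof. by case: j => [|j] jk; [rewrite hi0 | have := @i_step j.+1; lia]. Qed.

Lemma i_mono2 j j' : (j <= j' <= k.+1)%N -> (i j <= i j')%N.
Proof.
case/andP; elim: j' => [|j' IHj] jj' j'k; first by rewrite (_ : j = 0%N); lia.
have [->|ne] := eqVneq j j'.+1; first by [].
by apply: (leq_trans (IHj _ _)); [lia | lia | apply: i_mono; lia].
Qed.

Hypothesis hpk : p k.+1 = 0%N.

Lemma reach_block j x : (1 <= j <= k.+1)%N -> (i j.-1 < x <= i j)%N ->
  reach A x = (i j + p j).+1.
Proof.
move=> hj hx; apply/eqP; rewrite eqn_leq; apply/andP; split.
  have [jk|kj] := leqP j k; last first.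
    by rewrite (_ : j = k.+1) ?hik ?hpk ?addn0; [exact: reach_le | lia].
  have [_ h] := (leq_reach A x (reach A x)).1 (leqnn _).
  by apply: (h j) => /=; lia.
apply/leq_reach; split=> [|l hl xl] /=.
  have [jk|kj] := leqP j k; last by rewrite (_ : j = k.+1) ?hik ?hpk; lia.
  have [rel _] := hwf; have [|_ _] := rel j; move=> /=; lia.
have jl : (j <= l)%N.
  by rewrite leqNgt; apply/negP => lj; have := @i_mono2 l j.-1; move: xl => /=; lia.
have [->//|ne] := eqVneq l j.
have := @i_step j; have := @i_mono2 j.+1 l; move: hl => /=; lia.
Qed.

Lemma reach_top : reach A n.+1 = n.+1.
Proof.
apply/eqP; rewrite eqn_leq reach_le; apply/leq_reach; split=> // j hj /= nj.
by have [rel _] := hwf; have [_ _ /=] := rel j hj; lia.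
Qed.

(** On the last block, where p is 0, the only vertex in question is n + 1. *)
Definition next_reach j := if (j <= k)%N then (i j.+1 + p j.+1).+1 else n.+1.

Lemma reach_next j x : (1 <= j <= k.+1)%N -> (i j < x <= (i j + p j).+1)%N ->
  reach A x = next_reach j.
Proof.
move=> hj hx; rewrite /next_reach; case: leqP => jk.
  by apply: reach_block => //=; have := @i_step j; lia.
have ej : j = k.+1 by lia.
by rewrite (_ : x = n.+1) ?reach_top //; move: hx; rewrite ej hik hpk; lia.
Qed.

(** The relation that stops a ends at reach a, which by overlap-freeness is not
    past the start of the following relation; if b is stopped later than a then
    b and reach a lie in the same block. *)
Lemma reach_reach a b : (1 <= a)%N -> (a < b)%N -> (b <= reach A a)%N ->
  (reach A a < reach A b)%N -> reach A (reach A a) = reach A b.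
Proof.
move=> a1 ab ba lt; have := reach_le A b; rewrite /= => bn.
have [|j hj aj] := @block_cover i k.+1 a hi0.
  by rewrite hik; have := reach_le A a; move=> /=; lia.
have Ea := reach_block hj aj.
have ib : (i j < b)%N.
  by rewrite ltnNge; apply/negP => bi; move: lt; rewrite Ea (reach_block hj) ?ltnn //; lia.
by rewrite Ea in ba *; rewrite !(reach_next hj) //; lia.
Qed.

End OverlapFree.

Theorem theorem4p5 (F : closedFieldType) (n k : nat) (i p : nat -> nat)
    (A := BoundQuiver n k i p) (g : nat -> rat)
    (hn : (3 <= n)%N)
    (hwf : relations_wf A) (hof : overlap_free A)
    (hi0 : i 0%N = 0%N) (hik : i k.+1 = n) (hpk : p k.+1 = 0%N)
    (hg : forall j, (1 <= j <= k)%N ->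
       g j = (i j.+1)%:R + (p j.+1)%:R + (i j.-1)%:R - 2%:R * (i j)%:R
             - (2%:R * (p j)%:R + 1) / 3%:R)
    (hgk : g k.+1 = 0) :
  exists N : nat,
    num_exceptional_pairs F A N /\
    N%:R =
      ((\sum_(1 <= j < k.+2) (i j - i j.-1)%N%:R * (i j + p j)%N%:R)
         - (tri (n - 1))%:R) ^+ 2
      - \sum_(1 <= j < k.+2)
          (('C(i j - i j.-1 + 3, 4))%:R + ('C(i j - i j.-1 + 2, 4))%:R
           + (p j)%:R * (('C(i j - i j.-1 + 2, 3))%:R
                         + ('C(i j - i j.-1 + 1, 3))%:R))
      - \sum_(1 <= j < k.+2)
          (6%:R * (tri (i j - i j.-1))%:R
           + (i j - i j.-1)%N%:R * (2%:R * g j - 1)) * (tri (p j))%:R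
      :> rat.
Proof.
have RR := reach_reach hwf hof hik hi0 hpk.
exists (\sum_(1 <= a < n.+2) \sum_(1 <= b < n.+2)
        \sum_(1 <= c < n.+2) \sum_(1 <= d < n.+2) exc_quad A a b c d)%N.
split; first exact: num_exceptional_pairs_iv.
have rtop : reach A n.+1 = n.+1 by exact: (reach_top hwf).
have mono j : (j < k.+1)%N -> (i j <= i j.+1)%N by move=> jk; apply: (i_mono hwf hof hik hi0).
have sum_blocks (f : nat -> nat) : f n.+1 = 0%N ->
    (\sum_(1 <= x < n.+2) f x
     = \sum_(1 <= j < k.+2) \sum_((i j.-1).+1 <= x < (i j).+1) f x)%N.
  move=> f0; rewrite big_nat_recr //= f0 addn0 -{1}hik.
  exact: sum_block hi0 mono.
have blockE j x : (1 <= j < k.+2)%N -> (i j.-1 < x <= i j)%N -> reach A x = (i j + p j).+1.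
  by move=> hj; apply: (reach_block hwf hof hik hi0 hpk).
have nextE j x : (1 <= j < k.+2)%N -> (i j < x <= (i j + p j).+1)%N ->
    reach A x = next_reach n k i p j.
  by move=> hj; apply: (reach_next hwf hof hik hi0 hpk).
have mono1 j : (1 <= j < k.+2)%N -> (i j.-1 <= i j)%N.
  by case: j => // j hj; apply: mono.
have num_iv : (\sum_(1 <= a < n.+2) (reach A a - a))%N%:R
    = \sum_(1 <= j < k.+2) (i j - i j.-1)%N%:R * (i j + p j)%N%:R
      - (tri (n - 1))%:R :> rat.
  rewrite sum_blocks ?rtop ?subnn // natr_sum.
  pose tau (x : nat) : rat := x%:R * (x%:R - 1) / 2%:R.
  rewrite (eq_big_nat _ _ (F2 := fun j =>
      (i j - i j.-1)%N%:R * (i j + p j)%N%:R - (tau (i j) - tau (i j.-1)))).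
    rewrite sumrB (sum_nat_diff (fun j => tau (i j))) hik hi0; congr (_ - _).
    by rewrite triR natrB /tau; [field | lia].
  by move=> j hj; rewrite (@sum_E_sub _ _ _ (p j) (mono1 _ hj)) // => x hx; apply: blockE.
have NE := congr1 (fun N => N%:R : rat) (sum_exc_quad A).
rewrite natrD natrX num_iv in NE.
apply: (canRL (addrK _)); apply: (canRL (addrK _)); rewrite NE -addrA; congr (_ + _).
rewrite sum_blocks; last by rewrite /nonexc_from rtop !big_geq.
rewrite natr_sum -big_split /=; apply: eq_big_nat => j hj.
rewrite (@sum_nonexc_from _ _ _ (p j) (mono1 _ hj) _ (next_reach n k i p j)).
- have L : (i j)%:R = (i j.-1)%:R + (i j - i j.-1)%N%:R :> rat.
    by rewrite -natrD subnKC // mono1.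
  have [jk|kj] := leqP j k.
    rewrite hg; last by lia.
    rewrite /next_reach jk !triR L -!natr1 natrD.
    by field.
  have -> : j = k.+1 by lia.
  by rewrite hpk !triR; field.
- by move=> x; apply: blockE.
- rewrite /next_reach; have [jk|kj] := leqP j k.
    by have := @i_step _ _ _ _ hwf hof hik j; lia.
  by rewrite (_ : j = k.+1) ?hik ?hpk; lia.
by move=> x; apply: nextE.
Qed.
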